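(* Let $\mathcal F=\{G_\theta:\theta\in\Theta\}$ be the natural exponential family generated by $\beta=\sum_{k=0}^\infty c_k\delta_k$ with $c_k>0$ for all $k\in\mathbb{N}$, let $\{z_i\}_{i=1}^m$ be independent with CDFs $\{G_{\theta_i}\}_{i=1}^m$ belonging to $\mathcal F$, and let $\rho$ be a finite, positive constant. If $\frac1{c_kk!}\le\frac C{k!}$ for all $k\in\mathbb{N}$ and $H$ has a finite radius of convergence $R_H$, then for positive and sufficiently large $t$ $$\mathbb V\{\hat\varphi_m(t,\mathbf z)-\varphi_m(t,\boldsymbol\theta)\}\le\frac Cm\,\frac{\exp(2tR_H^{1/2})}{\sqrt t\,\phi_m(L,\boldsymbol\theta)},$$ where $\phi_m(L,\boldsymbol\theta)=\min_{1\le i\le m}\{L(\theta_i)\eta_i^{1/4}\}$, and a uniform consistency class is $$\tilde{\mathcal Q}_{\mathrm{II},1}(\boldsymbol\theta,t,\pi_{1,m};\gamma)=\left\{\begin{array}{c}\|\boldsymbol\theta\|_\infty\le\rho,\ t=2^{-1}R_H^{-1/2}\gamma\ln m,\\ \pi_{1,m}\ge m^{(\gamma-1)/2},\ \min_{i\in I_{1,m}}|\eta_0-\eta_i|\ge\frac{\ln\ln m}{\sqrt{2\ln m}}\end{array}\right\}$$ for any $\gamma\in(0,1]$.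
   Context: $\mathbb{N}=\{0,1,2,\dots\}$, $\delta_k$ is the Dirac mass at $k$. $L(\theta)=\int e^{x\theta}\beta(dx)$, $\Theta$ is the maximal open set of $\theta\in\mathbb{R}$ with $L(\theta)<\infty$ (assumed non-empty), $G_\theta(dx)=\exp\{\theta x-\ln L(\theta)\}\beta(dx)$. $H(z)=\sum_{k\ge0}c_kz^k$ is the generating function of $\beta$, so $H^{(k)}(0)=c_kk!$. $\theta_0\in\Theta$ is fixed; $\mathbf z=(z_1,\dots,z_m)$, $\boldsymbol\theta=(\theta_1,\dots,\theta_m)$, $\eta_i=e^{\theta_i}$ for $0\le i\le m$, $\|\cdot\|_\infty$ is the maximum norm; $I_{1,m}=\{1\le i\le m:\theta_i\ne\theta_0\}$, $\pi_{1,m}=|I_{1,m}|/m$; $\mathbb V$ denotes variance. $\omega:[-1,1]\to\mathbb{R}$ is admissible (non-negative, bounded, $\int_{[-1,1]}\omega(s)ds=1$), and $$K(t,x;\theta_0)=H(e^{\theta_0})\int_{[-1,1]}\frac{(ts)^x\cos\left(\frac{\pi x}2-tse^{\theta_0}\right)}{H^{(x)}(0)}\omega(s)ds,\qquad\psi(t,\theta;\theta_0)=\int K(t,x;\theta_0)dG_\theta(x),$$ $$\hat\varphi_m(t,\mathbf z)=\frac1m\sum_{i=1}^m\{1-K(t,z_i;\theta_0)\},\qquad\varphi_m(t,\boldsymbol\theta)=\frac1m\sum_{i=1}^m\{1-\psi(t,\theta_i;\theta_0)\}.$$ $\hat\varphi_m(t,\mathbf z)$ is the estimator of $\pi_{1,m}$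 to which the claim refers. $C$ denotes a generic, positive constant whose values may differ at different occurrences. Uniform consistency class: a sequence of sets $\mathcal Q_m$ of pairs (parameter vector $\boldsymbol\theta$, $t$), $m=1,2,\dots$, is called a uniform consistency class for $\hat\varphi_m(t,\mathbf z)$ if $$\Pr\left\{\sup_{\boldsymbol\theta\in\mathcal Q_m}\left|\pi_{1,m}^{-1}\sup_{t\in\mathcal Q_m}\hat\varphi_m(t,\mathbf z)-1\right|\to0\right\}\to1.$$
   Formalization: As the law of z depends on θ, the supremum over θ inside one probability is undefined (and false for one common z); uniform consistency is stated as convergence in probability of the ratio to 1, uniformly over θ in the class. *)

(* Defs.v *)
From HB Require Import structures.
From mathcomp Require Import all_boot all_order all_algebra.
From mathcomp Require Import all_classical all_reals all_analysis.

Set Implicit Arguments.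
Unset Strict Implicit.
Unset Printing Implicit Defensive.

Import Order.TTheory GRing.Theory Num.Theory.
Import numFieldNormedType.Exports.

Local Open Scope classical_set_scope.
Local Open Scope ring_scope.

(* [H z] is the junk value of [limn] where the series diverges. *)
Definition gen_fun (R : realType) (c : nat -> R) (z : R) : R :=
  limn (pseries c z).

Definition cvg_radius (R : realType) (c : nat -> R) : \bar R :=
  ereal_sup [set r%:E | r in [set r : R | 0 <= r /\ cvgn (pseries c r)]].

(* Mutual independence of a finite family; taking some of the [A i] to be
   [setT] gives the product rule for every subfamily. *)
Definition independent_RVs (d d' : measure_display) (T : measurableType d) (T' : measurableType d')
    (R : realType) (P : probability T R) (m : nat)
    (z : 'I_m -> {RV P >-> T'}) : Prop :=
  forall A : 'I_m -> set T', (forall i, measurable (A i)) ->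
    P (\bigcap_(i in [set: 'I_m]) (z i @^-1` A i)) =
    (\prod_(i < m) P (z i @^-1` A i))%E.

Section natural_exponential_family.
Context {R : realType} (c : nat -> {nonneg R}).

(* The base measure is supported by the natural numbers, so it is defined on
   the discrete measurable space [nat]. *)
Definition base_measure : {measure set nat -> \bar R} :=
  mseries (fun k => mscale (c k) \d_k) 0.

Definition laplace (theta : R) : \bar R :=
  (\int[base_measure]_x (expR (x%:R * theta))%:E)%E.

Definition nef_domain : set R := interior [set theta | (laplace theta < +oo)%E].

Definition nef (theta : R) (A : set nat) : \bar R :=
  (\int[base_measure]_(x in A)
     (expR (theta * x%:R - ln (fine (laplace theta))))%:E)%E.

Section nef_measure.
Variable theta : R.

Let nef0 : nef theta set0 = 0%E.
Proof. by rewrite /nef integral_set0. Qed.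

Let nef_ge0 A : (0 <= nef theta A)%E.
Proof. by apply: integral_ge0 => x _; rewrite lee_fin expR_ge0. Qed.

Let nef_sigma_additive : semi_sigma_additive (nef theta).
Proof.
by apply: semi_sigma_additive_nng_induced => // x; rewrite lee_fin expR_ge0.
Qed.

HB.instance Definition _ := isMeasure.Build _ _ _ (nef theta)
  nef0 nef_ge0 nef_sigma_additive.

End nef_measure.

Definition nef_sample d (T : measurableType d) (P : probability T R) (m : nat)
    (z : 'I_m -> {RV P >-> nat}) (theta : 'rV[R]_m) : Prop :=
  [/\ forall i, nef_domain (theta ord0 i),
      independent_RVs z &
      forall i (A : set nat), measurable A ->
        distribution P (z i) A = nef (theta ord0 i) A].

End natural_exponential_family.

(* [omega] is only ever evaluated on [-1, 1]. *)
Definition admissible (R : realType) (omega : R -> R) : Prop :=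
  [/\ measurable_fun (`[-1, 1]%classic : set R) omega,
      {in `[-1, 1], forall s, 0 <= omega s},
      exists M : R, {in `[-1, 1], forall s, omega s <= M} &
      (\int[lebesgue_measure]_(s in `[(-1)%R, 1%R]) (omega s)%:E = 1)%E].

Section estimator.
Context {R : realType} (c : nat -> {nonneg R}) (omega : R -> R) (theta0 : R).

Local Notation H := (gen_fun (fun k => (c k)%:num)).

Definition Kfun (t : R) (x : nat) : R :=
  H (expR theta0) *
  \int[lebesgue_measure]_(s in `[-1, 1])
    ((t * s) ^+ x * cos (pi * x%:R / 2 - t * s * expR theta0)
       / derive1n x H 0 * omega s).

Definition psi (t theta : R) : R := \int[nef c theta]_x Kfun t x.

Definition phi_hat (m : nat) (t : R) (z : 'I_m -> nat) : R :=
  m%:R^-1 * \sum_(i < m) (1 - Kfun t (z i)).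

Definition phi (m : nat) (t : R) (theta : 'rV[R]_m) : R :=
  m%:R^-1 * \sum_(i < m) (1 - psi t (theta ord0 i)).

Definition nonnull (m : nat) (theta : 'rV[R]_m) : {set 'I_m} :=
  [set i | theta ord0 i != theta0]%SET.

Definition nonnull_proportion (m : nat) (theta : 'rV[R]_m) : R :=
  #|nonnull theta|%:R / m%:R.

(* The law of [z] depends on the parameter vector, so [Pr] is the probability
   under [theta], and [| X_m | -> 0 with Pr -> 1, sup over theta] is convergence
   in probability to 0, uniformly over the parameter vectors of [Q m].  It is
   required of every probability space carrying a sample with the given laws
   (the probability below depends on the joint law only). *)
Definition uniform_consistency_class
    (Q : forall m : nat, set ('rV[R]_m * R)) : Prop :=
  forall eps delta : R, 0 < eps -> 0 < delta ->
  \forall m \near \oo,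
  forall (theta : 'rV[R]_m), (exists t, Q m (theta, t)) ->
  forall (d : measure_display) (T : measurableType d) (P : probability T R)
         (z : 'I_m -> {RV P >-> nat}), nef_sample c z theta ->
  ((1 - delta)%:E <=
   P [set w |
      `| ((nonnull_proportion theta)^-1)%:E *
         ereal_sup [set (phi_hat t (fun i => z i w))%:E |
                      t in [set t | Q m (theta, t)]] - 1 | <= eps%:E])%E.

(* The infimum of a finite set; a minimum when [0 < m]. *)
Definition phi_L (m : nat) (theta : 'rV[R]_m) : R :=
  inf (range (fun i : 'I_m =>
    fine (laplace c (theta ord0 i)) * expR (theta ord0 i) `^ (4^-1))).

(* For row vectors [`|theta|] is the maximum norm. *)
Definition Q_II1 (RH rho gamma : R) (m : nat) : set ('rV[R]_m * R) :=
  [set p : 'rV[R]_m * R |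
     [/\ `|p.1| <= rho,
         p.2 = 2^-1 * RH `^ (- 2^-1) * gamma * ln m%:R,
         m%:R `^ ((gamma - 1) / 2) <= nonnull_proportion p.1 &
         forall i, i \in nonnull p.1 ->
           ln (ln m%:R) / Num.sqrt (2 * ln m%:R)
             <= `|expR theta0 - expR (p.1 ord0 i)|]].

End estimator.

(* Main.v *)
Require Import Defs.
From mathcomp Require Import all_boot all_order all_algebra.
From mathcomp Require Import all_classical all_reals all_analysis.
From mathcomp Require Import measurable_realfun ring lra.
Import Order.TTheory GRing.Theory Num.Theory.
Import numFieldNormedType.Exports.

(** Write eta = e^theta and eta0 = e^theta0.  In the moments of the kernel
    K(t, x) the derivative of the generating function in the denominator, which
    is x! c_x, cancels the weight c_x of the laws G_theta.

    Variance.  Since 1 / c_x <= C0, the second moment of K(t, z) under G_theta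
    is at most H(eta0)^2 C0 / L(theta) times the sum over x of
    (t sqrt eta)^(2x) / (x!)^2, the modified Bessel function I_0 at the point
    2 t sqrt eta.  The elementary estimate I_0(2w) <= e^(2w) / sqrt w of
    [bessel_partial_le], together with eta <= RH, bounds the variance of a
    single summand ([variance_Kfun_le]); independence divides it by m
    ([variance_phi_hat_le]).

    Bias.  Summing the Taylor series of the cosine under the integral gives
    psi(t, theta) = H(eta0) / L(theta) times the integral of
    cos (t (eta - eta0) s) omega(s) over [-1, 1] ([psiE]).  It equals one when
    theta = theta0, and it tends to zero when t |eta - eta0| tends to infinity,
    by the Riemann-Lebesgue lemma ([riemann_lebesgue]).  On the class the
    separation of the eta_i from eta0 forces t |eta_i - eta0| to grow at least
    like sqrt (ln m), so that phi_m / pi_{1,m} tends to one uniformly.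

    Consistency.  For t = gamma ln m / (2 sqrt RH) the factor exp(2 t sqrt RH)
    is m^gamma, hence the variance is of order m^(gamma - 1) / sqrt t, whereas
    pi_{1,m}^2 >= m^(gamma - 1).  By Chebyshev's inequality the probability of
    a given relative deviation of phi_hat from phi is at most a constant times
    1 / sqrt t, which tends to zero ([consistency_class_Q_II1]). *)

Set Implicit Arguments.
Unset Strict Implicit.
Unset Printing Implicit Defensive.
Local Open Scope classical_set_scope.
Local Open Scope ring_scope.

(** * A Bessel-type bound *)

(** The square of the bound 4^n / sqrt (2n + 1) for the central binomial
    coefficient; the inductive step is (2n + 1)(2n + 3) <= (2n + 2)^2. *)
Lemma fact_double_le (R : realType) (n : nat) :
  ((n.*2)`!%:R ^+ 2 * (n.*2.+1)%:R : R) <= 16 ^+ n * n`!%:R ^+ 4.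
Proof.
elim: n => [|n IHn]; first by rewrite !fact0 !expr1n expr0 !mul1r.
rewrite doubleS !factS !natrM.
have -> : n.*2.+3%:R = 3 + 2 * n%:R :> R by rewrite -addn3 -mul2n natrD natrM addrC.
have -> : n.*2.+2%:R = 2 + 2 * n%:R :> R by rewrite -addn2 -mul2n natrD natrM addrC.
have E : n.*2.+1%:R = 1 + 2 * n%:R :> R by rewrite -addn1 -mul2n natrD natrM addrC.
have -> : n.+1%:R = 1 + n%:R :> R by rewrite -addn1 natrD addrC.
rewrite E in IHn *; move: IHn.
set a := _`!%:R; set b := _`!%:R; have := ler0n R n; set x := n%:R => x0 IHn.
rewrite [16 ^+ n.+1]exprSr [leRHS](_ : _ = (16 ^+ n * b ^+ 4) * (16 * (1 + x) ^+ 4)); last by ring.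
apply: (@le_trans _ _ ((a ^+ 2 * (1 + 2 * x)) * (16 * (1 + x) ^+ 4))); last first.
  by apply: ler_wpM2r => //; rewrite mulr_ge0// exprn_ge0//; lra.
rewrite [leLHS](_ : _ = (a ^+ 2 * (1 + 2 * x)) *
  ((2 + 2 * x) ^+ 2 * ((1 + 2 * x) * (3 + 2 * x)))); last by ring.
apply: ler_wpM2l; first by rewrite mulr_ge0 ?sqr_ge0//; lra.
rewrite (_ : 16 * _ = (2 + 2 * x) ^+ 2 * (2 * (1 + x)) ^+ 2); last by ring.
apply: ler_wpM2l; first by rewrite sqr_ge0.
nra.
Qed.

(** By [fact_double_le] the left side is at most
    y^(2n) / (2n)! / sqrt (2n + 1) for y = 2w.  The arithmetic-geometric mean
    inequality 2 / sqrt (2n + 1) <= sqrt y / (2n + 1) + 1 / sqrt y replaces the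
    inverse square root by two consecutive terms of the exponential series, so
    that the sum over n becomes an exponential. *)
Lemma sqr_coef_le (R : realType) (w : R) (n : nat) : 0 < w ->
  (w ^+ n / n`!%:R) ^+ 2 <=
  2^-1 / Num.sqrt (2 * w) *
  ((2 * w) ^+ n.*2 / n.*2`!%:R + (2 * w) ^+ n.*2.+1 / n.*2.+1`!%:R).
Proof.
move=> w0.
have y0 : 0 < 2 * w by lra.
have b0 : 0 < Num.sqrt (2 * w) by rewrite sqrtr_gt0.
have bE : Num.sqrt (2 * w) ^+ 2 = 2 * w by rewrite sqr_sqrtr// ltW.
set b := Num.sqrt _ in b0 bE *.
pose a : R := (Num.sqrt n.*2.+1%:R)^-1.
have a0 : 0 < a by rewrite invr_gt0 sqrtr_gt0 ltr0n.
have aE : a ^+ 2 = n.*2.+1%:R^-1 by rewrite /a exprVn sqr_sqrtr.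
have f0 k : 0 < k`!%:R :> R by rewrite ltr0n fact_gt0.
have H1 : (w ^+ n / n`!%:R) ^+ 2 <= (2 * w) ^+ n.*2 / n.*2`!%:R * a.
  rewrite expr_div_n ler_pdivrMr ?exprn_gt0//.
  have -> : (2 * w) ^+ n.*2 = (w ^+ n) ^+ 2 * 4 ^+ n.
    have -> : 4 = 2 ^+ 2 :> R by ring.
    by rewrite -mul2n exprM exprMn exprMn [2 ^+ 2 ^+ n]exprAC; ring.
  have Z0 := sqr_ge0 (w ^+ n); set Z := (w ^+ n) ^+ 2 in Z0 *.
  clearbody Z.
  rewrite -[X in X <= _]mulr1 -!mulrA; apply: ler_wpM2l; first exact: Z0.
  rewrite -[leLHS](@mulfV _ (n.*2`!%:R / a)); last by rewrite mulf_neq0 ?invr_eq0 ?gt_eqF.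
  rewrite [leRHS](_ : _ = (4 ^+ n * n`!%:R ^+ 2) * (n.*2`!%:R / a)^-1); last first.
    by rewrite invfM invrK; ring.
  apply: ler_wpM2r; first by rewrite invr_ge0 divr_ge0 ?ltW.
  rewrite -(@ler_pXn2r _ 2) ?nnegrE ?divr_ge0 ?mulr_ge0 ?exprn_ge0 ?(ltW a0)//.
  rewrite exprMn exprVn aE invrK.
  have := fact_double_le R n; congr (_ <= _).
  have -> : 16 = 4 ^+ 2 :> R by ring.
  by rewrite [RHS]exprMn [4 ^+ 2 ^+ n]exprAC; ring.
apply: (le_trans H1).
rewrite factS natrM exprS invfM -aE -bE.
set P := (b ^+ 2) ^+ _ / _; have P0 : 0 <= P by rewrite divr_ge0 // exprn_ge0 // sqr_ge0.
rewrite [leRHS](_ : _ = P * (2^-1 * (b^-1 + b * a ^+ 2))); last first.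
  by rewrite /P; field; rewrite !gt_eqF.
apply: ler_wpM2l => //.
(* The arithmetic-geometric mean inequality as a completed square. *)
suff: 0 <= b^-1 * (a * b - 1) ^+ 2.
  rewrite [_ * _](_ : _ = b^-1 + b * a ^+ 2 - 2 * a); last by field; rewrite gt_eqF.
  lra.
by rewrite mulr_ge0 ?sqr_ge0// invr_ge0 ltW.
Qed.

Lemma sum_exp_coeff_le (R : realType) (y : R) (n : nat) : 0 <= y ->
  \sum_(0 <= k < n) y ^+ k / k`!%:R <= expR y.
Proof.
move=> y0; apply: (@nondecreasing_cvgn_le _ (series (exp_coeff y))).
  by apply: nondecreasing_series => k _ _; rewrite divr_ge0// exprn_ge0.
exact: is_cvg_series_exp_coeff.
Qed.

(** The sums on the left increase to I_0(2w), for I_0 the modified Bessel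
    function.  The factor 1 / sqrt w is essential below: it is the only one
    that makes the relative variance tend to zero. *)
Lemma bessel_partial_le (R : realType) (w : R) (n : nat) : 0 < w ->
  \sum_(0 <= k < n) (w ^+ k / k`!%:R) ^+ 2 <= expR (2 * w) / Num.sqrt w.
Proof.
move=> w0.
have y0 : 0 < 2 * w by lra.
apply: (@le_trans _ _ (2^-1 / Num.sqrt (2 * w) *
    \sum_(0 <= k < n.*2) (2 * w) ^+ k / k`!%:R)).
  rewrite -[n.*2]muln2 mulnC; elim: n => [|n IHn].
    by rewrite !big_geq// mulr0.
  rewrite big_nat_recr//= mulnS !big_nat_recr//= -addrA mulrDr lerD//.
  by have := sqr_coef_le n w0; rewrite -mul2n.
rewrite mulrC; apply: ler_pM.
- by apply: sumr_ge0 => k _; rewrite divr_ge0 ?exprn_ge0 ?ltW.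
- by rewrite divr_ge0 ?sqrtr_ge0.
- by apply: sum_exp_coeff_le; exact: ltW.
- have : Num.sqrt w <= Num.sqrt (2 * w) by rewrite ler_sqrt ?ltW//; lra.
  have : 0 < Num.sqrt w by rewrite sqrtr_gt0.
  move=> s0 ss; rewrite -[leRHS]mul1r ler_pM ?invr_ge0 ?sqrtr_ge0//; first lra.
  by rewrite lef_pV2// posrE (lt_le_trans s0).
Qed.

(** * The shifted cosine series *)

Lemma cos_natpihalf (R : realType) (n : nat) :
  cos (pi * n%:R / 2) = (~~ odd n)%:R * (-1) ^+ n./2 :> R /\
  sin (pi * n%:R / 2) = (odd n)%:R * (-1) ^+ n.-1./2 :> R.
Proof.
have step k : pi * k.+2%:R / 2 = pi * k%:R / 2 + pi :> R.
  by rewrite -(addn2 k) natrD; field.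
suff H : forall k, (cos (pi * k.*2%:R / 2) = (-1) ^+ k :> R /\
   sin (pi * k.*2%:R / 2) = 0 :> R) /\ (cos (pi * k.*2.+1%:R / 2) = 0 :> R /\
   sin (pi * k.*2.+1%:R / 2) = (-1) ^+ k :> R).
  have [[ca sa] [cb sb]] := H n./2.
  case: (boolP (odd n)) => on; have := odd_double_half n.
    rewrite on add1n => <- /=; rewrite uphalf_double doubleK mul0r mul1r.
    by rewrite cb sb.
  rewrite (negbTE on) add0n => <-; rewrite doubleK mul0r mul1r.
  by rewrite ca sa.
elim=> [|k [[ca sa] [cb sb]]].
  by rewrite !mulr0 mul0r mulr1 cos0 sin0 cos_pihalf sin_pihalf.
rewrite doubleS !step !cosDpi !sinDpi ca sa cb sb !oppr0.
by rewrite exprS mulN1r.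
Qed.

(** The real part of e^(-iv) times the exponential series of iu. *)
Lemma cvg_cos_shift_series (R : realType) (u v : R) :
  series (fun k => u ^+ k / k`!%:R * cos (pi * k%:R / 2 - v)) @ \oo -->
  cos (u - v).
Proof.
have -> : (fun k => u ^+ k / k`!%:R * cos (pi * k%:R / 2 - v)) =
    cos v *: cos_coeff u + sin v *: sin_coeff u.
  apply/funext => k; rewrite cosB.
  have [-> ->] := cos_natpihalf R k.
  rewrite !fctE /cos_coeff /sin_coeff /GRing.scale/= -!exprnP; ring.
rewrite cosB mulrC [sin u * _]mulrC.
have -> : series (cos v *: cos_coeff u + sin v *: sin_coeff u) =
    cos v *: series (cos_coeff u) + sin v *: series (sin_coeff u).
  apply/funext => n; rewrite /series !fctE /= big_split/= -!scaler_sumr//.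
apply: cvgD; apply: cvgZl_tmp.
- by have := @is_cvg_series_cos_coeff _ u; rewrite unlock.
- by have := @is_cvg_series_sin_coeff _ u; rewrite unlock.
Qed.

(** * The Riemann-Lebesgue lemma *)

Section riemann_lebesgue.
Context {R : realType}.
Implicit Types (f g : R -> R) (x y : R).
Local Notation mu := (@lebesgue_measure R).
Local Notation D := (`[(-1)%R, 1%R]%classic : set R).

Definition bounded_measurable f :=
  measurable_fun D f /\ exists M, forall s, D s -> `|f s| <= M.

Lemma bounded_measurable_integrable f :
  bounded_measurable f -> mu.-integrable D (EFin \o f).
Proof.
move=> [mf [M fM]]; apply: measurable_bounded_integrable => //.
  by rewrite /= lebesgue_measure_itv/= lte_fin; case: ifP => _; rewrite -?EFinB ltry.
exists M; split; first exact: num_real.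
by move=> y My s Ds /=; rewrite (le_trans (fM _ Ds))// ltW.
Qed.

Lemma bounded_measurableM f g : bounded_measurable f -> bounded_measurable g ->
  bounded_measurable (fun s => f s * g s).
Proof.
move=> [mf [M fM]] [mg [N gN]]; split; first exact: measurable_funM.
by exists (M * N) => s Ds; rewrite normrM ler_pM// ?fM ?gN.
Qed.

Lemma bounded_measurableB f g : bounded_measurable f -> bounded_measurable g ->
  bounded_measurable (fun s => f s - g s).
Proof.
move=> [mf [M fM]] [mg [N gN]]; split; first exact: measurable_funB.
exists (M + N) => s Ds; rewrite (le_trans (ler_normB _ _))// lerD// ?fM ?gN//.
Qed.

Lemma bounded_measurableD f g : bounded_measurable f -> bounded_measurable g ->
  bounded_measurable (fun s => f s + g s).
Proof.
move=> [mf [M fM]] [mg [N gN]]; split; first exact: measurable_funD.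
exists (M + N) => s Ds; rewrite (le_trans (ler_normD _ _))// lerD// ?fM ?gN//.
Qed.

Lemma bounded_measurable_cst x : bounded_measurable (fun=> x).
Proof. by split => //; exists `|x|. Qed.

Lemma bounded_measurable_cos x y : bounded_measurable (fun s => cos (x * s - y)).
Proof.
split; last by exists 1 => s _; exact: cos_max.
apply: measurable_funTS; apply: measurableT_comp.
  by apply: continuous_measurable_fun; exact: continuous_cos.
by apply: measurable_funB => //; apply: measurable_funM.
Qed.

Lemma bounded_measurable_cos0 x : bounded_measurable (fun s => cos (x * s)).
Proof.
have := bounded_measurable_cos x 0; congr bounded_measurable.
by apply/funext => s; rewrite subr0.
Qed.

Lemma Rintegral_cos x : x != 0 ->
  \int[mu]_(s in D) cos (x * s) = 2 * sin x / x.
Proof.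
move=> x0; pose F s := x^-1 * sin (x * s).
have dF (s : R) : is_derive s 1 F (cos (x * s)).
  apply: is_derive_eq.
  by rewrite /GRing.scale/= mulr1 mulrC mulfK.
have cF : continuous F.
  by move=> s; apply: differentiable_continuous; apply/derivable1_diffP; exact: ex_derive.
rewrite /Rintegral (@continuous_FTC2 _ _ F) //=.
- by rewrite /F mulr1 mulrN1 sinN; field.
- apply: continuous_subspaceT => s; apply: continuous_comp; last exact: continuous_cos.
  by apply: mulrl_continuous.
- split.
  + by move=> s _; exact: ex_derive.
  + by apply: cvg_at_right_filter; exact: cF.
  + by apply: cvg_at_left_filter; exact: cF.
- by move=> s _; rewrite derive1E; exact: derive_val.
Qed.

Lemma normr_Rintegral_cos_le x : 0 < x ->
  `|\int[mu]_(s in D) cos (x * s)| <= 2 / x.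
Proof.
move=> x0; rewrite Rintegral_cos ?gt_eqF// !normrM normfV (gtr0_norm x0).
rewrite (gtr0_norm (_ : 0 < 2))//; apply: ler_wpM2r; first by rewrite invr_ge0 ltW.
by have := sin_max x; lra.
Qed.

Lemma normr_Rintegral_coscos_le x y : 0 < x < y ->
  `|\int[mu]_(s in D) (cos (y * s) * cos (x * s))| <= 2 / (y - x).
Proof.
move=> /andP[x0 xy].
have -> : \int[mu]_(s in D) (cos (y * s) * cos (x * s)) =
    2^-1 * (\int[mu]_(s in D) cos ((y - x) * s) +
            \int[mu]_(s in D) cos ((y + x) * s)).
  rewrite -RintegralD//; last 2 first.
    exact/bounded_measurable_integrable/bounded_measurable_cos0.
    exact/bounded_measurable_integrable/bounded_measurable_cos0.
  rewrite -RintegralZl//; last first.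
    by apply/bounded_measurable_integrable/bounded_measurableD;
      exact: bounded_measurable_cos0.
  apply: eq_Rintegral => s _; rewrite mulrBl mulrDl cosB cosD.
  by field.
have d0 : 0 < y - x by rewrite subr_gt0.
have d1 : 0 < y + x by lra.
have H1 := normr_Rintegral_cos_le d0; have H2 := normr_Rintegral_cos_le d1.
have H3 : 2 / (y + x) <= 2 / (y - x) by rewrite ler_pM2l// lef_pV2 ?posrE//; lra.
rewrite normrM gtr0_norm ?invr_gt0//.
have := ler_normD (\int[mu]_(s in D) cos ((y - x) * s)) (\int[mu]_(s in D) cos ((y + x) * s)).
lra.
Qed.

Definition fourier_cos f x := \int[mu]_(s in D) (cos (x * s) * f s).

(** The hypothesis on [f] says that the limes superior of |fourier_cos f| at
    infinity is at least e.  Let g be f minus plus or minus (e / 4) cos (x s),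
    for a frequency x with |fourier_cos f x| >= e / 2 and the sign of
    fourier_cos f x: its energy is smaller by at least
    2 (e / 4) (e / 2) - 2 (e / 4)^2 = e^2 / 8.  The limes superior is still at
    least e, because cosines of distant frequencies are almost orthogonal. *)
Lemma energy_decrement f e : bounded_measurable f -> 0 < e ->
  (forall e', e' < e -> forall L, exists2 x, L <= x & e' <= `|fourier_cos f x|) ->
  exists g, [/\ bounded_measurable g,
    forall e', e' < e -> forall L, exists2 x, L <= x & e' <= `|fourier_cos g x| &
    \int[mu]_(s in D) (g s * g s) <= \int[mu]_(s in D) (f s * f s) - e ^+ 2 / 8].
Proof.
move=> bf e0 hf.
have [x x1 ex] : exists2 x, 1 <= x & e / 2 <= `|fourier_cos f x| by apply: hf; lra.
pose k := e / 4 * Num.sg (fourier_cos f x).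
pose h s := k * cos (x * s).
have bc := bounded_measurable_cos0.
have bh : bounded_measurable h by apply: bounded_measurableM => //; exact: bounded_measurable_cst.
have bM := bounded_measurableM; have bB := bounded_measurableB.
have bI := bounded_measurable_integrable; have bk := bounded_measurable_cst k.
have nk : `|k| <= e / 4.
  rewrite normrM ger0_norm ?divr_ge0 ?(ltW e0)// normr_sg.
  by case: (_ != 0); rewrite ?mulr1 ?mulr0 ?divr_ge0 ?(ltW e0).
exists (fun s => f s - h s); split; first exact: bB.
- move=> e' e'e L.
  pose d := (e - e') / 2.
  have d0 : 0 < d by rewrite /d; lra.
  have [y yL ey] : exists2 y, Order.max L (x + e / d) <= y & (e + e') / 2 <= `|fourier_cos f y|.
    by apply: hf; lra.
  (* A gap of e / d between x and y keeps the correction at y below d / 2. *)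
  move: yL; rewrite ge_max => /andP[yL yx]; exists y => //.
  have ed0 : 0 < e / d by rewrite divr_gt0.
  have -> : fourier_cos (fun s => f s - h s) y =
      fourier_cos f y - k * \int[mu]_(s in D) (cos (y * s) * cos (x * s)).
    rewrite -RintegralZl//; last by apply: bI; apply: bM.
    rewrite -RintegralB//.
    - by apply: eq_Rintegral => s _; rewrite /h; ring.
    - by apply: bI; apply: bM.
    - by apply: bI; apply: (bM _ _ bk); apply: bM.
  have xy : 0 < x < y by apply/andP; split; lra.
  have := normr_Rintegral_coscos_le xy.
  set I := (X in `|X| <= _) => HI.
  have : 2 / (y - x) <= 2 / (e / d) by rewrite ler_pM2l// lef_pV2 ?posrE//; lra.
  rewrite invf_div => H2.
  have : `|k * I| <= e / 4 * (2 * (d / e)).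
    by rewrite normrM; apply: ler_pM => //; apply: le_trans HI _.
  rewrite (_ : e / 4 * _ = d / 2); last by field; rewrite gt_eqF.
  have := lerB_normD (fourier_cos f y) (- (k * I)); rewrite normrN /d; lra.
- have -> : \int[mu]_(s in D) ((f s - h s) * (f s - h s)) =
      \int[mu]_(s in D) (f s * f s) - 2 * k * fourier_cos f x
      + k ^+ 2 * \int[mu]_(s in D) (cos (x * s) * cos (x * s)).
    rewrite -RintegralZl//; last by apply: bI; apply: bM.
    rewrite -RintegralZl//; last by apply: bI; apply: bM.
    have b2 := bM _ _ (bounded_measurable_cst (2 * k)) (bM _ _ (bc x) bf).
    have b3 := bM _ _ (bounded_measurable_cst (k ^+ 2)) (bM _ _ (bc x) (bc x)).
    rewrite -RintegralB//; [|by apply: bI; apply: bM|exact: bI].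
    rewrite -RintegralD//; [|apply: bI; apply: bB => //; exact: bM|exact: bI].
    by apply: eq_Rintegral => s _; rewrite /h; ring.
  have I2 : \int[mu]_(s in D) (cos (x * s) * cos (x * s)) <= 2.
    have -> : 2 = \int[mu]_(s in D) (1:R).
      have N11 : -1 < 1 :> R by lra.
      by rewrite Rintegral_cst//= lebesgue_measure_itv/= lte_fin N11/= mul1r opprK.
    apply: le_Rintegral => //.
    - by apply: bI; apply: bM.
    - exact/bI/bounded_measurable_cst.
  have kf : k * fourier_cos f x = e / 4 * `|fourier_cos f x|.
    by rewrite /k -mulrA -normrEsg.
  have k2 : k ^+ 2 <= e ^+ 2 / 16.
    rewrite -real_normK ?num_real// (_ : e ^+ 2 / 16 = (e / 4) ^+ 2); last by field.
    by rewrite lerXn2r// nnegrE divr_ge0// ltW.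
  have : k ^+ 2 * \int[mu]_(s in D) (cos (x * s) * cos (x * s)) <= e ^+ 2 / 16 * 2.
    apply: ler_pM => //; first exact: sqr_ge0.
    by apply: Rintegral_ge0 => s _; rewrite -expr2 sqr_ge0.
  have : e / 4 * (e / 2) <= e / 4 * `|fourier_cos f x| by apply: ler_wpM2l => //; lra.
  have -> : 2 * k * fourier_cos f x = 2 * (e / 4 * `|fourier_cos f x|).
    by rewrite -mulrA kf.
  rewrite [e / 4 * (e / 2)](_ : _ = e ^+ 2 / 8); last by field.
  move: (e ^+ 2) (_ * `|_|) (\int[mu]_(s in D) (f s * f s)) (k ^+ 2 * _) => E A F G.
  clear; lra.
Qed.

(** Otherwise [energy_decrement] could be iterated until the energy of the
    remaining function became negative. *)
Lemma riemann_lebesgue f e : bounded_measurable f -> 0 < e ->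
  exists L, forall x, L <= `|x| -> `|fourier_cos f x| < e.
Proof.
move=> bf e0; apply: contrapT => H.
have {H} : forall e', e' < e -> forall L, exists2 x, L <= x & e' <= `|fourier_cos f x|.
  move=> e' e'e L; apply: contrapT => H'; apply: H; exists L => x Lx.
  rewrite ltNge; apply/negP => ex; apply: H'; exists `|x| => //.
  apply: ltW; apply: (lt_le_trans e'e); apply: (le_trans ex).
  rewrite le_eqVlt; apply/orP; left; apply/eqP; congr (`|_|).
  apply: eq_Rintegral => s _; congr (_ * _).
  by rewrite -cos_norm -[RHS]cos_norm !normrM normr_id.
have e8 : 0 < e ^+ 2 / 8 by rewrite divr_gt0// exprn_gt0.
have [n] : exists n : nat, \int[mu]_(s in D) (f s * f s) <= n%:R * (e ^+ 2 / 8).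
  exists (Num.truncn (\int[mu]_(s in D) (f s * f s) / (e ^+ 2 / 8))).+1.
  by rewrite -ler_pdivrMr// ltW// truncnS_gt.
elim: n f bf => [|n IHn] f bf fn hf.
- have [g [bg _ gf]] := energy_decrement bf e0 hf.
  have g0 : 0 <= \int[mu]_(s in D) (g s * g s).
    by apply: Rintegral_ge0 => s _; rewrite -expr2 sqr_ge0.
  suff: 0 < 0 :> R by rewrite ltxx.
  by apply: (le_lt_trans (le_trans g0 gf)); rewrite subr_lt0 (le_lt_trans fn)// mul0r.
- have [g [bg hg gf]] := energy_decrement bf e0 hf.
  apply: (IHn g bg _ hg); apply: (le_trans gf).
  by rewrite lerBlDr (le_trans fn)// -natr1 mulrDl mul1r.
Qed.
End riemann_lebesgue.

(** * Derivatives at zero of a generating function *)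

Section gen_fun_derivatives.
Context {R : realType}.
Implicit Types (c : nat -> R).

(** As k + 1 <= 2^k, a geometric bound on the coefficients survives
    differentiation with its ratio doubled.  Hence one bound on the
    coefficients controls all the derivatives near zero. *)
Lemma pseries_diffs_geom_bound c (M q : R) :
  (forall k, `|c k| <= M * q ^+ k) ->
  forall k, `|pseries_diffs c k| <= M * q * (2 * q) ^+ k.
Proof.
move=> cM k; rewrite /pseries_diffs normrM normr_nat exprMn.
have Mq0 : 0 <= M * q ^+ k.+1 by apply: le_trans (cM k.+1).
rewrite [leRHS](_ : _ = 2 ^+ k * (M * q ^+ k.+1)); last by rewrite exprS; ring.
apply: ler_pM => //.
by rewrite -natrX ler_nat ltn_expl.
Qed.

Lemma is_cvg_pseries_geom c (M q x : R) : 0 < q ->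
  (forall k, `|c k| <= M * q ^+ k) -> `|x| < q^-1 -> cvgn (pseries c x).
Proof.
move=> q0 cM xq; apply: normed_cvg.
have M0 : 0 <= M by have := le_trans (normr_ge0 _) (cM 0%N); rewrite expr0 mulr1.
apply: (@series_le_cvg _ _ (geometric M (q * `|x|))) => //=.
- by move=> n; rewrite mulr_ge0// exprn_ge0// mulr_ge0// ltW.
- move=> n; rewrite normrM normrX exprMn mulrA.
  by apply: ler_wpM2r => //; exact: cM.
- apply: is_cvg_geometric_series; rewrite ger0_norm; last by rewrite mulr_ge0// ltW.
  by rewrite mulrC -ltr_pdivlMr// mul1r.
Qed.

Lemma near0_derive1_gen_fun c (M q : R) : 0 < q ->
  (forall k, `|c k| <= M * q ^+ k) ->
  \forall z \near 0, derive1 (gen_fun c) z = gen_fun (pseries_diffs c) z.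
Proof.
move=> q0 cM.
have q20 : 0 < 2 * q by rewrite mulr_gt0.
have q40 : 0 < 2 * (2 * q) by rewrite mulr_gt0.
have c1 := pseries_diffs_geom_bound cM; have c2 := pseries_diffs_geom_bound c1.
(* Two differentiations turn the ratio q into 4 q, so that the common point of
   convergence has to lie below 1 / (4 q). *)
pose K := (5 * q)^-1.
have K0 : 0 < K by rewrite invr_gt0 mulr_gt0.
have Kq a : 0 < a -> a < 5 -> `|K| < (a * q)^-1.
  by move=> a0 a5; rewrite gtr0_norm// ltf_pV2 ?posrE ?mulr_gt0// ltr_pM2r.
have nK : \forall z \near (0 : R), `|z| < K.
  by apply/nbhs_ballP; exists K => //= z; rewrite /ball/= sub0r normrN.
near=> z; rewrite derive1E.
have [||||_ ->//] := @pseries_snd_diffs R c K z.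
- by apply: (is_cvg_pseries_geom q0 cM); rewrite -(mul1r q); apply: Kq; lra.
- by apply: (is_cvg_pseries_geom q20 c1); apply: Kq; lra.
- by apply: (is_cvg_pseries_geom q40 c2); rewrite mulrA; apply: Kq; lra.
- by rewrite (gtr0_norm K0); near: z; exact: nK.
Unshelve. all: by end_near. Qed.

(** An equality on a neighbourhood of zero, and not only at zero, since the
    induction differentiates it again. *)
Lemma near0_derive1n_gen_fun n c (M q : R) : 0 < q ->
  (forall k, `|c k| <= M * q ^+ k) ->
  \forall z \near 0, derive1n n (gen_fun c) z = gen_fun (iter n (@pseries_diffs R) c) z.
Proof.
elim: n c M q => [|n IHn] c M q q0 cM; first by near=> z.
have q20 : 0 < 2 * q by rewrite mulr_gt0.
have {}IHn := IHn _ _ _ q20 (pseries_diffs_geom_bound cM).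
have H := near0_derive1_gen_fun q0 cM.
have : forall k, \forall z \near (0 : R),
    derive1n k (derive1 (gen_fun c)) z =
    derive1n k (gen_fun (pseries_diffs c)) z.
  elim=> [//|k IHk]; have := near_join IHk; apply: filterS => z IHz.
  by rewrite !derive1nS !derive1E; exact: near_eq_derive.
move=> /(_ n); apply: filterS2 IHn => z IHz.
by rewrite derive1Sn => ->; rewrite IHz iterSr.
Unshelve. all: by end_near. Qed.

Lemma gen_fun0 c : gen_fun c 0 = c 0%N.
Proof.
apply: lim_near_cst => //; exists 1%N => // n /= n1.
rewrite /pseries /series /= -(prednK n1) big_nat_recl// expr0 mulr1.
by rewrite big1 ?addr0// => i _; rewrite expr0n mulr0.
Qed.

Lemma iter_pseries_diffs n c k :
  iter n (@pseries_diffs R) c k * k`!%:R = (n + k)`!%:R * c (n + k)%N.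
Proof.
elim: n k => [|n IHn] k; first by rewrite /= add0n mulrC.
rewrite iterS /pseries_diffs addSnnS -IHn factS natrM; ring.
Qed.

Lemma derive1n_gen_fun0 n c (M q : R) : 0 < q ->
  (forall k, `|c k| <= M * q ^+ k) ->
  derive1n n (gen_fun c) 0 = n`!%:R * c n.
Proof.
move=> q0 cM; rewrite (nbhs_singleton (near0_derive1n_gen_fun n q0 cM)) gen_fun0.
by have := iter_pseries_diffs n c 0; rewrite addn0 fact0 mulr1.
Qed.
End gen_fun_derivatives.

(** * Discrete measures and natural exponential families *)

Section discrete.
Context {R : realType}.
Local Open Scope ereal_scope.

Lemma integral_nat_set1 (mu : {measure set nat -> \bar R}) (f : nat -> R) k :
  \int[mu]_(x in [set k]) (f x)%:E = (f k)%:E * mu [set k].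
Proof.
rewrite (eq_integral (cst (f k)%:E)) ?integral_cst//.
by move=> x /[!inE] ->.
Qed.

Lemma bigcup_nat_set1 : \bigcup_k [set k] = [set: nat].
Proof. by apply/seteqP; split => // k _; exists k. Qed.

Lemma trivIset_set1 : trivIset setT (fun k : nat => [set k]).
Proof. by move=> i j _ _ [k [-> ->]]. Qed.

Lemma ge0_integral_nat (mu : {measure set nat -> \bar R}) (f : nat -> R) :
  (forall k, 0 <= f k)%R ->
  \int[mu]_x (f x)%:E = \sum_(k <oo) (f k)%:E * mu [set k].
Proof.
move=> f0; rewrite -bigcup_nat_set1 ge0_integral_bigcup//.
- by apply: eq_eseriesr => k _; exact: integral_nat_set1.
- by move=> x _; rewrite lee_fin.
- exact: trivIset_set1.
Qed.

Lemma integral_nat (mu : {measure set nat -> \bar R}) (f : nat -> R) :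
  mu.-integrable setT (EFin \o f) ->
  \int[mu]_x (f x)%:E = \sum_(k <oo) (f k)%:E * mu [set k].
Proof.
move=> fi; rewrite -bigcup_nat_set1 integral_bigcup//.
- by apply: eq_eseriesr => k _; exact: integral_nat_set1.
- exact: trivIset_set1.
- by rewrite bigcup_nat_set1.
Qed.

Lemma base_measure_set1 (c : nat -> {nonneg R}) k :
  base_measure c [set k] = (c k)%:num%:E.
Proof.
rewrite /base_measure /= /mseries (@nneseriesD1 _ _ k)//=.
rewrite /mscale/= diracE mem_set// mule1 eseries0 ?adde0//.
move=> i _ /= ik; rewrite diracE memNset ?mule0//= => ki.
by rewrite ki eqxx in ik.
Qed.

Lemma nef_set1 (c : nat -> {nonneg R}) theta k :
  nef c theta [set k] =
  (expR (theta * k%:R - ln (fine (laplace c theta))) * (c k)%:num)%:E.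
Proof. by rewrite /nef integral_nat_set1 base_measure_set1 EFinM. Qed.

Lemma laplaceE (c : nat -> {nonneg R}) theta :
  laplace c theta = \sum_(k <oo) ((c k)%:num * expR theta ^+ k)%:E.
Proof.
rewrite /laplace ge0_integral_nat; last by move=> k; exact: expR_ge0.
by apply: eq_eseriesr => k _; rewrite base_measure_set1 -EFinM mulrC expRM_natl.
Qed.

Lemma laplace_ge (c : nat -> {nonneg R}) theta : (0 < (c 0%N)%:num)%R ->
  (c 0%N)%:num%:E <= laplace c theta.
Proof.
move=> c0; rewrite laplaceE.
have := @nneseries_lim_ge R (fun k => ((c k)%:num * expR theta ^+ k)%:E) xpredT 0%N 1%N.
rewrite big_nat1 expr0 mulr1; apply => k _ _.
by rewrite lee_fin mulr_ge0// exprn_ge0// expR_ge0.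
Qed.

Lemma cvg_pseries_laplace (c : nat -> {nonneg R}) theta : laplace c theta < +oo ->
  pseries (fun k => (c k)%:num) (expR theta) @ \oo --> fine (laplace c theta).
Proof.
move=> Lfin.
have t0 k : (0 <= (c k)%:num * expR theta ^+ k)%R.
  by rewrite mulr_ge0// exprn_ge0// expR_ge0.
have L0 : 0 <= laplace c theta by rewrite laplaceE; apply: nneseries_ge0 => k _ _; rewrite lee_fin.
have : (fun n => \sum_(0 <= k < n) ((c k)%:num * expR theta ^+ k)%:E) @ \oo -->
    laplace c theta.
  by rewrite laplaceE; apply: is_cvg_nneseries => k _ _; rewrite lee_fin.
rewrite -(@fineK _ (laplace c theta)) ?ge0_fin_numE// => /fine_cvg.
apply: cvg_trans; apply: near_eq_cvg; apply: nearW => n /=.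
by rewrite sumEFin.
Qed.

Lemma gen_fun_laplace (c : nat -> {nonneg R}) theta : laplace c theta < +oo ->
  gen_fun (fun k => (c k)%:num) (expR theta) = fine (laplace c theta).
Proof. by move=> /cvg_pseries_laplace/cvg_lim; exact. Qed.

Lemma nef_domain_laplace (c : nat -> {nonneg R}) theta : nef_domain c theta ->
  laplace c theta < +oo.
Proof. by move=> /interior_subset. Qed.

Lemma nef_set1E (c : nat -> {nonneg R}) theta k : (0 < (c 0%N)%:num)%R ->
   nef_domain c theta ->
  nef c theta [set k] =
  ((c k)%:num * expR theta ^+ k / fine (laplace c theta))%:E.
Proof.
move=> c0 /nef_domain_laplace Lfin; rewrite nef_set1; congr EFin.
have L0 := laplace_ge theta c0.
rewrite expRB lnK ?posrE.
  by rewrite expRM_natr; ring.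
by apply: fine_gt0; rewrite Lfin andbT (lt_le_trans _ L0)// lte_fin.
Qed.

Lemma expR_le_cvg_radius (c : nat -> {nonneg R}) theta (RH : R) :
  cvg_radius (fun k => (c k)%:num) = RH%:E ->
  nef_domain c theta -> (expR theta <= RH)%R.
Proof.
move=> cR /nef_domain_laplace Lfin; rewrite -lee_fin -cR.
apply: ereal_sup_ubound; exists (expR theta) => //; split; first exact: expR_ge0.
by apply/cvg_ex; eexists; exact: cvg_pseries_laplace.
Qed.
End discrete.

(** * Sums of independent discrete random variables *)

Section independence.
Local Open Scope ereal_scope.
Context d (T : measurableType d) (R : realType) (P : probability T R).

Lemma Lfun2_bounded (X : T -> R) (M : R) : measurable_fun setT X ->
  (forall w, `|X w| <= M)%R -> X \in Lfun P 2%:E.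
Proof.
move=> mX XM; rewrite inE; apply/andP; split; first by rewrite inE/=.
rewrite inE/= /finite_norm unlock poweR_lty//.
apply: (@le_lt_trans _ _ (\int[P]_x (cst (M ^+ 2)%:E x))).
  apply: ge0_le_integral => //.
  - by move=> w _; exact: poweR_ge0.
  - rewrite /=; apply/measurable_EFinP.
    apply/(@measurableT_comp _ _ _ _ _ _ (fun x : R => x `^ 2)%R) => //.
    exact/measurableT_comp.
  - move=> w _ /=; rewrite lee_fin powR_mulrn// lerXn2r ?nnegrE//.
    by rewrite (le_trans _ (XM w)).
by rewrite integral_cst//= probability_setT mule1 ltry.
Qed.

Lemma independent_RVs_pair m (z : 'I_m -> {RV P >-> nat}) i j (A B : set nat) :
  independent_RVs z -> i != j ->
  P (z i @^-1` A `&` z j @^-1` B) = P (z i @^-1` A) * P (z j @^-1` B).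
Proof.
move=> iz ij.
pose S k : set nat := if k == i then A else if k == j then B else setT.
have ji : j == i = false by rewrite eq_sym (negbTE ij).
have := iz S (fun=> I).
rewrite (bigD1 i)//= (bigD1 j)/=; last by rewrite ji.
rewrite {2 3}/S eqxx ji eqxx big1 ?mule1; last first.
  by move=> k /andP[ki kj]; rewrite /S (negbTE ki) (negbTE kj) preimage_setT probability_setT.
move=> <-; congr (P _); apply/seteqP; split => [w [wA wB] k _|w Sw].
  by rewrite /S /preimage/=; case: eqP => [->//|_]; case: eqP => [->//|_].
by split; [have := Sw i Logic.I|have := Sw j Logic.I]; rewrite /S /preimage/= ?ji eqxx.
Qed.

(** The joint law of the two variables is the product of their laws, so that
    Fubini's theorem factors the integral. *)
Lemma expectationM_independent m (z : 'I_m -> {RV P >-> nat}) i j (f g : nat -> R) (M N : R) :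
  independent_RVs z -> i != j ->
  (forall k, `|f k| <= M)%R -> (forall k, `|g k| <= N)%R ->
  'E_P[(f \o z i) * (g \o z j)] = 'E_P[f \o z i] * 'E_P[g \o z j].
Proof.
move=> iz ij fM gN.
have mf (h : nat -> R) : measurable_fun setT h by [].
have mzz : measurable_fun setT (fun w => (z i w, z j w)).
  by apply/measurable_fun_pair => //.
have mX (k : 'I_m) (h : nat -> R) : measurable_fun setT (h \o z k) by exact: measurableT_comp.
have M0 : (0 <= M)%R by rewrite (le_trans _ (fM 0%N)).
pose F (p : nat * nat) : R := (f p.1 * g p.2)%R.
have mF : measurable_fun setT F.
  by apply: measurable_funM; apply: measurableT_comp.
have FB p : (`|F p| <= M * N)%R by rewrite normrM ler_pM.
have intF : P.-integrable setT ((EFin \o F) \o (fun w => (z i w, z j w))).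
  apply: measurable_bounded_integrable => //.
  - exact: fin_num_fun_lty (fin_num_measure P).
  - exact: (measurableT_comp mF mzz).
  - exists (M * N)%R; split; first exact: num_real.
    by move=> y My w _ /=; rewrite (le_trans (FB _))// ltW.
have imf : (distribution P (z i) \x distribution P (z j)).-integrable setT (EFin \o F).
  apply: measurable_bounded_integrable => //.
  - apply: (@le_lt_trans _ _ ((distribution P (z i) \x distribution P (z j))
        (setT `*` setT))); first by rewrite setXTT.
    by rewrite product_measure1E//= !probability_setT mule1 ltry.
  - exists (M * N)%R; split; first exact: num_real.
    by move=> y My w _ /=; rewrite (le_trans (FB _))// ltW.
transitivity (\int[distribution P (z i) \x distribution P (z j)]_p (F p)%:E).
  rewrite unlock.
  have -> : \int[P]_w (((f \o z i) * (g \o z j)) w)%:E =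
      \int[pushforward P (fun w => (z i w, z j w))]_p (F p)%:E.
    by rewrite integral_pushforward//; exact/measurable_EFinP.
  apply: eq_measure_integral => S mS _; symmetry.
  apply: product_measure_unique => // A B mA mB.
  by rewrite -(independent_RVs_pair _ _ iz ij).
rewrite -integral12_prod_meas1// /fubini_F.
have bI (k : 'I_m) (h : nat -> R) (K : R) : (forall n, `|h n| <= K)%R ->
    (distribution P (z k)).-integrable setT (EFin \o h).
  move=> hK; apply: measurable_bounded_integrable => //.
  - exact: fin_num_fun_lty (fin_num_measure _).
  - exists K; split; first exact: num_real.
    by move=> y My w _ /=; rewrite (le_trans (hK _))// ltW.
have bI' (k : 'I_m) (h : nat -> R) (K : R) : (forall n, `|h n| <= K)%R ->
    P.-integrable setT (EFin \o (h \o z k)).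
  move=> hK; apply: measurable_bounded_integrable => //.
  - exact: fin_num_fun_lty (fin_num_measure _).
  - exists K; split; first exact: num_real.
    by move=> y My w _ /=; rewrite (le_trans (hK _))// ltW.
have ED (k : 'I_m) (h : nat -> R) (K : R) : (forall n, `|h n| <= K)%R ->
    'E_P[h \o z k] = \int[distribution P (z k)]_x (h x)%:E.
  move=> hK; rewrite unlock integral_distribution//; last exact: bI' hK.
rewrite (ED _ _ _ fM) (ED _ _ _ gN).
have fin : \int[distribution P (z j)]_y (g y)%:E \is a fin_num.
  by apply: integrable_fin_num => //; exact: bI gN.
rewrite -(fineK fin) -integralZr//; last exact: bI fM.
apply: eq_integral => x _; rewrite fineK//= -integralZl//; last exact: bI gN.
Qed.

Lemma variance_sum_independent m (z : 'I_m -> {RV P >-> nat}) (f : nat -> R) (M : R) :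
  independent_RVs z -> (forall k, `|f k| <= M)%R ->
  'V_P[fun w => \sum_(i < m) f (z i w)]%R = \sum_(i < m) 'V_P[f \o z i].
Proof.
move=> iz fM.
have L2 i : f \o z i \in Lfun P 2%:E.
  by apply: (@Lfun2_bounded _ M) => [|w]; [exact: measurableT_comp|exact: fM].
have Pfin : P setT \is a fin_num := fin_num_measure P _ measurableT.
have cov0 i j : i != j -> covariance P (f \o z i) (f \o z j) = 0.
  move=> ij; rewrite covarianceE ?Lfun2_mul_Lfun1 ?Lfun_subset12//.
  rewrite (expectationM_independent iz ij fM fM) subee//.
  by rewrite fin_numM// expectation_fin_num// Lfun_subset12.
(* The induction also carries that a partial sum is uncorrelated with each
   variable that does not occur in it. *)
have H (s : seq 'I_m) : uniq s ->
  [/\ (fun w => \sum_(i <- s) f (z i w))%R \in Lfun P 2%:E,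
    forall i, i \notin s -> covariance P (f \o z i) (fun w => \sum_(i <- s) f (z i w))%R = 0 &
    'V_P[fun w => \sum_(i <- s) f (z i w)]%R = \sum_(i <- s) 'V_P[f \o z i]].
  elim: s => [_|i s IHs /= /andP[ins us]].
    have -> : (fun w => \sum_(i <- [::]) f (z i w))%R = cst 0%R.
      by apply/funext => w; rewrite big_nil.
    by split => [|i _|]; rewrite ?Lfun_cst ?covariance_cst_r ?variance_cst ?big_nil.
  have [Ls cs Vs] := IHs us.
  have -> : (fun w => \sum_(i <- i :: s) f (z i w))%R =
      ((f \o z i) \+ (fun w => \sum_(i <- s) f (z i w)))%R.
    by apply/funext => w; rewrite big_cons.
  split.
  - by rewrite rpredD ?lee1n.
  - move=> j; rewrite inE negb_or => /andP[ji js].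
    by rewrite covarianceDr// cov0// cs// adde0.
  - by rewrite varianceD// cs// mule0 adde0 Vs big_cons.
by have [_ _] := H _ (index_enum_uniq 'I_m).
Qed.

Lemma expectation_sum_comp m (z : 'I_m -> {RV P >-> nat}) (f : nat -> R) (M : R) :
  (forall k, `|f k| <= M)%R ->
  'E_P[fun w => \sum_(i < m) f (z i w)]%R = \sum_(i < m) 'E_P[f \o z i].
Proof.
move=> fM.
have intf i : P.-integrable setT (EFin \o (f \o z i)).
  apply: measurable_bounded_integrable => //.
  - exact: fin_num_fun_lty (fin_num_measure P).
  - exact: measurableT_comp.
  - exists M; split; first exact: num_real.
    by move=> y My w _ /=; rewrite (le_trans (fM _))// ltW.
rewrite unlock.
under eq_integral do rewrite -sumEFin.
by rewrite integral_sum.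
Qed.

End independence.

(** * The kernel and its moments *)

Section kernel.
Context {R : realType} (c : nat -> {nonneg R}) (omega : R -> R) (theta0 C0 : R).
Hypothesis c_gt0 : forall k, 0 < (c k)%:num.
Hypothesis theta0_dom : nef_domain c theta0.
Hypothesis c_inv_le : forall k, (c k)%:num^-1 <= C0.
Hypothesis omega_adm : admissible omega.
Local Notation mu := (@lebesgue_measure R).
Local Notation D := (`[(-1)%R, 1%R]%classic : set R).
Local Notation H0 := (gen_fun (fun k => (c k)%:num) (expR theta0)).
Local Notation L theta := (fine (laplace c theta)).

Lemma admissible_bounded_measurable : bounded_measurable omega.
Proof.
have [mo o0 [M oM] _] := omega_adm; split => //; exists M => s Ds.
by rewrite ger0_norm ?oM ?o0.
Qed.

Lemma admissible_ge0 s : D s -> 0 <= omega s.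
Proof. by have [_ o0 _ _] := omega_adm; exact: o0. Qed.

Lemma Rintegral_admissible : \int[mu]_(s in D) omega s = 1.
Proof. by have [_ _ _ o1] := omega_adm; rewrite /Rintegral o1. Qed.

(** The weight omega is a probability density on [-1, 1]. *)
Lemma normr_mean_le (g : R -> R) (B : R) : bounded_measurable g ->
  (forall s, D s -> `|g s| <= B) ->
  `|\int[mu]_(s in D) (g s * omega s)| <= B.
Proof.
move=> bg gB; have bo := admissible_bounded_measurable.
have bgo := bounded_measurableM bg bo.
apply: le_trans (le_normr_Rintegral _ (bounded_measurable_integrable bgo)) _ => //.
apply: (@le_trans _ _ (\int[mu]_(s in D) (B * omega s))).
  apply: le_Rintegral => //.
  - exact: integrable_norm (bounded_measurable_integrable bgo).
  - exact/bounded_measurable_integrable/(bounded_measurableM _ bo)/bounded_measurable_cst.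
  - move=> s Ds; rewrite normrM (ger0_norm (admissible_ge0 Ds)).
    by apply: ler_wpM2r; [exact: admissible_ge0|exact: gB].
rewrite RintegralZl ?Rintegral_admissible ?mulr1//.
exact: bounded_measurable_integrable.
Qed.

(** The series converges at e^theta0, so that c_k <= L(theta0) e^(-k theta0):
    this is the geometric bound from which the derivatives are computed. *)
Lemma derive1n_base_gen_fun n :
  derive1n n (gen_fun (fun k => (c k)%:num)) 0 = n`!%:R * (c n)%:num.
Proof.
apply: (@derive1n_gen_fun0 _ n _ (L theta0) (expR (- theta0))); first exact: expR_gt0.
move=> k; have Lfin := nef_domain_laplace theta0_dom.
rewrite ger0_norm// expRN exprVn ler_pdivlMr ?exprn_gt0 ?expR_gt0//.
have t0 j : 0 <= (c j)%:num * expR theta0 ^+ j.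
  by rewrite mulr_ge0// exprn_ge0// expR_ge0.
have := nondecreasing_cvgn_le (nondecreasing_series (fun j _ _ => t0 j))
  (cvgP _ (cvg_pseries_laplace Lfin)) k.+1.
rewrite (cvg_lim _ (cvg_pseries_laplace Lfin))//; apply: le_trans.
by rewrite /series/= big_nat_recr//= lerDr sumr_ge0.
Qed.

Lemma fine_laplace_gt0 theta : nef_domain c theta -> 0 < L theta.
Proof.
move=> /nef_domain_laplace Lfin; apply: fine_gt0.
by rewrite Lfin andbT (lt_le_trans _ (laplace_ge theta (c_gt0 0)))// lte_fin.
Qed.

Lemma fine_laplace_ge theta : nef_domain c theta -> (c 0%N)%:num <= L theta.
Proof.
move=> dth; have /nef_domain_laplace Lfin := dth.
rewrite -lee_fin fineK ?laplace_ge// ge0_fin_numE// (le_trans _ (laplace_ge theta (c_gt0 0)))//.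
Qed.

Lemma gen_fun_gt0 : 0 < H0.
Proof.
by rewrite gen_fun_laplace ?fine_laplace_gt0//; exact: nef_domain_laplace.
Qed.

(** The x-th term, up to a factor eta^x, of the series of
    [cvg_cos_shift_series] at u = t s eta and v = t s eta0. *)
Definition kernel_integrand t x s :=
  (t * s) ^+ x / x`!%:R * cos (pi * x%:R / 2 - t * s * expR theta0).

Lemma bounded_measurable_kernel_integrand t x :
  bounded_measurable (kernel_integrand t x).
Proof.
apply: bounded_measurableM.
  apply: bounded_measurableM; last exact: bounded_measurable_cst.
  split; first by apply: measurable_funX; exact: measurable_funM.
  exists (`|t| ^+ x) => s; rewrite /= in_itv/= -ler_norml => s1.
  rewrite normrX normrM lerXn2r ?nnegrE ?mulr_ge0//.
  by rewrite -[leRHS]mulr1 ler_pM.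
have := bounded_measurable_cos (t * expR theta0) (pi * x%:R / 2).
congr bounded_measurable; apply/funext => s.
by rewrite -cosN opprB [t * _ * s]mulrAC.
Qed.

Lemma normr_kernel_integrand_le t x s : D s ->
  `|kernel_integrand t x s| <= `|t| ^+ x / x`!%:R.
Proof.
rewrite /= in_itv/= -ler_norml => s1.
rewrite /kernel_integrand normrM -[leRHS]mulr1 ler_pM ?cos_max//.
rewrite normrM normrX normrM normfV normr_nat.
apply: ler_wpM2r; first by rewrite invr_ge0.
by rewrite lerXn2r ?nnegrE ?mulr_ge0// -[leRHS]mulr1 ler_pM.
Qed.

Lemma KfunE t x : Kfun c omega theta0 t x =
  H0 / (c x)%:num * \int[mu]_(s in D) (kernel_integrand t x s * omega s).
Proof.
rewrite /Kfun derive1n_base_gen_fun -[RHS]mulrA; congr (_ * _).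
have bk := bounded_measurableM (bounded_measurable_kernel_integrand t x)
  admissible_bounded_measurable.
rewrite -RintegralZl//; last exact: bounded_measurable_integrable.
apply: eq_Rintegral => s _; rewrite /kernel_integrand invfM; ring.
Qed.

Lemma normr_Kfun_le t x : `|Kfun c omega theta0 t x| <=
  H0 / (c x)%:num * (`|t| ^+ x / x`!%:R).
Proof.
have A0 : 0 <= H0 / (c x)%:num by rewrite divr_ge0// ltW// gen_fun_gt0.
rewrite KfunE normrM (ger0_norm A0); apply: ler_wpM2l => //.
apply: normr_mean_le; first exact: bounded_measurable_kernel_integrand.
exact: normr_kernel_integrand_le.
Qed.

(** The weights c_k of the law cancel the factors 1 / c_k of the kernel, which
    leaves the partial sums of a Taylor series under the integral. *)
Lemma partial_sum_Kfun t theta n : nef_domain c theta ->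
  \sum_(0 <= k < n) Kfun c omega theta0 t k * ((c k)%:num * expR theta ^+ k / L theta) =
  H0 / L theta * \int[mu]_(s in D)
    (series (fun k => (t * s * expR theta) ^+ k / k`!%:R *
       cos (pi * k%:R / 2 - t * s * expR theta0)) n * omega s).
Proof.
move=> dth; have bo := admissible_bounded_measurable.
pose f n s := series (fun k => (t * s * expR theta) ^+ k / k`!%:R *
  cos (pi * k%:R / 2 - t * s * expR theta0)) n.
have fS k s : f k.+1 s = f k s + expR theta ^+ k * kernel_integrand t k s.
  by rewrite /f /series/= big_nat_recr//= exprMn /kernel_integrand; congr (_ + _); ring.
suff [_ ->] : bounded_measurable (f n) /\
   \int[mu]_(s in D) (f n s * omega s) =
   \sum_(0 <= k < n) expR theta ^+ k * \int[mu]_(s in D) (kernel_integrand t k s * omega s).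
  rewrite mulr_sumr; apply: eq_bigr => k _; rewrite KfunE.
  by field; rewrite !gt_eqF// fine_laplace_gt0.
elim: n => [|n [IHb IHn]].
  have -> : f 0%N = cst 0 by apply/funext => s; rewrite /f /series/= big_geq.
  split; first exact: bounded_measurable_cst.
  rewrite big_geq//; under eq_Rintegral do rewrite mul0r.
  by rewrite Rintegral_cst// mul0r.
have bk := bounded_measurable_kernel_integrand t n.
have be := bounded_measurableM (bounded_measurable_cst (expR theta ^+ n)) bk.
have -> : f n.+1 = fun s => f n s + expR theta ^+ n * kernel_integrand t n s.
  exact/funext.
split; first exact: bounded_measurableD.
rewrite big_nat_recr//= -IHn -RintegralZl//; last first.
  exact/bounded_measurable_integrable/bounded_measurableM.
rewrite -RintegralD//.
- by apply: eq_Rintegral => s _; ring.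
- exact/bounded_measurable_integrable/bounded_measurableM.
- apply/bounded_measurable_integrable/bounded_measurableM; first exact: bounded_measurable_cst.
  exact: bounded_measurableM.
Qed.

(** Dominated convergence: the partial sums are bounded by e^(|t| eta) on
    [-1, 1]. *)
Lemma cvg_partial_sum_Kfun t theta : nef_domain c theta ->
  \sum_(0 <= k < n) Kfun c omega theta0 t k * ((c k)%:num * expR theta ^+ k / L theta)
    @[n --> \oo] -->
  H0 / L theta * fourier_cos omega (t * (expR theta - expR theta0)).
Proof.
move=> dth; under eq_fun do rewrite (partial_sum_Kfun _ _ dth).
have bo := admissible_bounded_measurable.
pose f n s := series (fun k => (t * s * expR theta) ^+ k / k`!%:R *
  cos (pi * k%:R / 2 - t * s * expR theta0)) n.
apply: cvgMl_tmp.
pose B := expR (`|t| * expR theta).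
have fB n s : D s -> `|f n s| <= B.
  rewrite /= in_itv/= -ler_norml => s1; rewrite /f /series/=.
  apply: le_trans (ler_norm_sum _ _ _) _.
  apply: (@le_trans _ _ (\sum_(0 <= k < n) (`|t| * expR theta) ^+ k / k`!%:R)).
    apply: ler_sum => k _; rewrite normrM -[leRHS]mulr1 ler_pM ?cos_max//.
    rewrite normrM normfV normr_nat; apply: ler_wpM2r; first by rewrite invr_ge0.
    rewrite normrX lerXn2r ?nnegrE ?mulr_ge0 ?expR_ge0// !normrM.
    rewrite (ger0_norm (expR_ge0 _)); apply: ler_wpM2r; first exact: expR_ge0.
    by rewrite -[leRHS]mulr1 ler_pM.
  by apply: sum_exp_coeff_le; rewrite mulr_ge0// expR_ge0.
have mf n : measurable_fun D (f n).
  rewrite /f /series/=; apply: measurable_sum => k.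
  have := bounded_measurableM (bounded_measurable_cst (expR theta ^+ k))
    (bounded_measurable_kernel_integrand t k).
  case=> + _; congr measurable_fun; apply/funext => s.
  by rewrite /kernel_integrand [(t * s * expR theta) ^+ k]exprMn; ring.
have bg : bounded_measurable (fun s => B * omega s).
  by apply: bounded_measurableM => //; exact: bounded_measurable_cst.
have [|||||_ _ H] := @dominated_convergence _ _ _ mu D (measurable_itv _)
  (fun n s => (f n s * omega s)%:E)
  (fun s => (cos (t * (expR theta - expR theta0) * s) * omega s)%:E)
  (fun s => (B * omega s)%:E).
- by move=> n; apply/measurable_EFinP/measurable_funM; [exact: mf|case: bo].
- apply/measurable_EFinP/measurable_funM; last by case: bo.
  exact: (proj1 (bounded_measurable_cos0 (t * (expR theta - expR theta0)))).
- apply: aeW => s Ds; apply: cvg_EFin; first exact: nearW.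
  apply: cvgMr_tmp.
  rewrite (_ : _ * s = t * s * expR theta - t * s * expR theta0); last by ring.
  exact: cvg_cos_shift_series.
- exact: bounded_measurable_integrable.
- apply: aeW => s n Ds; rewrite lee_fin normrM (ger0_norm (admissible_ge0 Ds)).
  by apply: ler_wpM2r; [exact: admissible_ge0|exact: fB].
rewrite /fourier_cos /Rintegral; apply: fine_cvg; rewrite fineK; first exact: H.
apply: integrable_fin_num => //.
exact/bounded_measurable_integrable/(bounded_measurableM (bounded_measurable_cos0 _)).
Qed.

Lemma nef_setT theta : nef_domain c theta -> nef c theta setT = 1%E.
Proof.
move=> dth; have L0 := fine_laplace_gt0 dth; have Lfin := nef_domain_laplace dth.
rewrite /nef; under eq_integral => x _ do
  rewrite [theta * _]mulrC addrC expRD EFinM.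
rewrite ge0_integralZl//.
rewrite -/(laplace c theta) -(@fineK _ (laplace c theta)); last first.
  by rewrite ge0_fin_numE// (le_trans _ (laplace_ge theta (c_gt0 0))).
by rewrite -EFinM expRN lnK ?posrE// mulVf// gt_eqF.
Qed.

(** The lower bound on the coefficients c_k makes the kernel bounded, hence
    square integrable for every law on the natural numbers. *)
Lemma normr_Kfun_le_cst t x : `|Kfun c omega theta0 t x| <= H0 * C0 * expR `|t|.
Proof.
have h0 := gen_fun_gt0; apply: le_trans (normr_Kfun_le t x) _.
have C00 : 0 <= C0 by apply: le_trans (c_inv_le 0).
apply: ler_pM; rewrite ?divr_ge0 ?exprn_ge0 ?(ltW h0)//.
  by apply: ler_wpM2l => //; exact: ltW.
apply: le_trans (sum_exp_coeff_le x.+1 (normr_ge0 t)).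
by rewrite big_nat_recr//= lerDr sumr_ge0// => k _; rewrite divr_ge0// exprn_ge0.
Qed.

Lemma Kfun_nef_integrable t theta : nef_domain c theta ->
  (nef c theta).-integrable setT (EFin \o Kfun c omega theta0 t).
Proof.
move=> dth; apply: measurable_bounded_integrable => //.
  by apply: (@le_lt_trans _ _ 1%E); [rewrite -(nef_setT dth)|exact: ltry].
exists (H0 * C0 * expR `|t|); split; first exact: num_real.
by move=> y My s _ /=; rewrite (le_trans (normr_Kfun_le_cst _ _))// ltW.
Qed.

Lemma integral_Kfun_nef t theta : nef_domain c theta ->
  (\int[nef c theta]_x (Kfun c omega theta0 t x)%:E)%E =
  (H0 / L theta * fourier_cos omega (t * (expR theta - expR theta0)))%:E.
Proof.
move=> dth; rewrite integral_nat; last exact: Kfun_nef_integrable.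
apply/cvg_lim => //.
rewrite [X in X @ _ --> _](_ : _ = fun n => (\sum_(0 <= k < n)
    Kfun c omega theta0 t k * ((c k)%:num * expR theta ^+ k / L theta))%:E).
  by apply: cvg_EFin; [exact: nearW|exact: cvg_partial_sum_Kfun].
apply/funext => n; rewrite -sumEFin; apply: eq_bigr => k _.
by rewrite /= nef_set1E.
Qed.

Lemma psiE t theta : nef_domain c theta -> psi c omega theta0 t theta =
  H0 / L theta * fourier_cos omega (t * (expR theta - expR theta0)).
Proof. by move=> dth; rewrite /psi /Rintegral integral_Kfun_nef. Qed.

Lemma psi_null t : psi c omega theta0 t theta0 = 1.
Proof.
rewrite psiE// subrr mulr0 gen_fun_laplace; last exact: nef_domain_laplace.
rewrite divff ?gt_eqF ?fine_laplace_gt0// mul1r /fourier_cos.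
under eq_Rintegral do rewrite mul0r cos0 mul1r.
exact: Rintegral_admissible.
Qed.

(** Of the two factors 1 / c_k in the squared kernel, one cancels the weight of
    the law and the other is at most C0; what remains is the sum of
    [bessel_partial_le] at w = t sqrt eta. *)
Lemma integral_sqr_Kfun_le t theta : 0 < t -> nef_domain c theta ->
  (\int[nef c theta]_x (Kfun c omega theta0 t x ^+ 2)%:E <=
  (H0 ^+ 2 * C0 / L theta * (expR (2 * (t * Num.sqrt (expR theta))) /
     Num.sqrt (t * Num.sqrt (expR theta))))%:E)%E.
Proof.
move=> t0 dth; have L0 := fine_laplace_gt0 dth; have h0 := gen_fun_gt0.
rewrite ge0_integral_nat; last by move=> k; exact: sqr_ge0.
have C00 : 0 <= C0 by apply: le_trans (c_inv_le 0).
have w0 : 0 < t * Num.sqrt (expR theta) by rewrite mulr_gt0// sqrtr_gt0 expR_gt0.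
apply: lime_le.
  by apply: is_cvg_nneseries => k _ _; rewrite mule_ge0// lee_fin sqr_ge0.
apply: nearW => n; under eq_bigr do rewrite /= nef_set1E// -EFinM.
rewrite sumEFin lee_fin.
apply: (@le_trans _ _ (H0 ^+ 2 * C0 / L theta *
    \sum_(0 <= k < n) ((t * Num.sqrt (expR theta)) ^+ k / k`!%:R) ^+ 2)); last first.
  apply: ler_wpM2l; last exact: bessel_partial_le.
  by rewrite divr_ge0 ?(ltW L0)// mulr_ge0// sqr_ge0.
rewrite mulr_sumr; apply: ler_sum => k _.
have ck := c_gt0 k; have fk : 0 < k`!%:R :> R by rewrite ltr0n fact_gt0.
apply: (@le_trans _ _ ((H0 / (c k)%:num * (t ^+ k / k`!%:R)) ^+ 2 *
    ((c k)%:num * expR theta ^+ k / L theta))).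
  apply: ler_wpM2r.
    by rewrite divr_ge0 ?(ltW L0)// mulr_ge0// exprn_ge0// expR_ge0.
  rewrite -real_normK ?num_real// lerXn2r// ?nnegrE//.
    by rewrite mulr_ge0 ?divr_ge0 ?exprn_ge0 ?(ltW h0) ?(ltW t0).
  by have := normr_Kfun_le t k; rewrite (gtr0_norm t0).
have sk : Num.sqrt (expR theta) ^+ k ^+ 2 = expR theta ^+ k.
  by rewrite exprAC sqr_sqrtr// expR_ge0.
rewrite [X in X <= _](_ : _ =
    (H0 ^+ 2 / L theta * (t ^+ k / k`!%:R) ^+ 2 * expR theta ^+ k) * (c k)%:num^-1); last first.
  by field; rewrite !gt_eqF.
rewrite [X in _ <= X](_ : _ =
    (H0 ^+ 2 / L theta * (t ^+ k / k`!%:R) ^+ 2 * expR theta ^+ k) * C0); last first.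
  by rewrite [(t * _) ^+ k]exprMn -sk; field; rewrite !gt_eqF.
apply: ler_wpM2l => //.
apply: mulr_ge0; last by rewrite exprn_ge0// expR_ge0.
by apply: mulr_ge0; rewrite ?sqr_ge0// divr_ge0 ?sqr_ge0 ?ltW.
Qed.

(** In the exponent eta is bounded by RH; the denominator
    sqrt (t sqrt eta) is kept and split as sqrt t times eta^(1/4). *)
Lemma integral_sqr_Kfun_radius_le (RH t theta : R) :
  cvg_radius (fun k => (c k)%:num) = RH%:E -> 0 < t -> nef_domain c theta ->
  (\int[nef c theta]_x (Kfun c omega theta0 t x ^+ 2)%:E <=
  (H0 ^+ 2 * C0 * (expR (2 * t * RH `^ (2^-1)) /
     (Num.sqrt t * (L theta * expR theta `^ (4^-1)))))%:E)%E.
Proof.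
move=> RHr t0 dth; apply: le_trans (integral_sqr_Kfun_le t0 dth) _.
have L0 := fine_laplace_gt0 dth; have e0 := expR_gt0 theta.
have C00 : 0 <= C0 by apply: le_trans (c_inv_le 0).
have eR := expR_le_cvg_radius RHr dth; have RH0 := lt_le_trans e0 eR.
have -> : expR theta `^ (4^-1) = Num.sqrt (Num.sqrt (expR theta)).
  by rewrite -powR12_sqrt ?sqrtr_ge0// -powR12_sqrt ?expR_ge0// -powRrM -invfM -natrM.
rewrite sqrtrM ?(ltW t0)// powR12_sqrt ?(ltW RH0)// lee_fin.
have s0 : 0 < Num.sqrt (Num.sqrt (expR theta)) by rewrite !sqrtr_gt0.
have st0 : 0 < Num.sqrt t by rewrite sqrtr_gt0.
rewrite [X in X <= _](_ : _ = H0 ^+ 2 * C0 * (expR (2 * (t * Num.sqrt (expR theta))) /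
   (Num.sqrt t * (L theta * Num.sqrt (Num.sqrt (expR theta)))))); last first.
  by field; rewrite !gt_eqF.
apply: ler_wpM2l; first by rewrite mulr_ge0// sqr_ge0.
apply: ler_wpM2r; first by rewrite invr_ge0 !mulr_ge0// ltW.
rewrite ler_expR -mulrA ler_pM2l// ler_pM2l//.
by rewrite ler_sqrt// ltW.
Qed.

End kernel.

(** * Mean and variance of the estimator *)

Section estimator_moments.
Context {R : realType} (c : nat -> {nonneg R}) (omega : R -> R) (theta0 C0 RH : R).
Hypothesis c_gt0 : forall k, 0 < (c k)%:num.
Hypothesis theta0_dom : nef_domain c theta0.
Hypothesis c_inv_le : forall k, (c k)%:num^-1 <= C0.
Hypothesis omega_adm : admissible omega.
Hypothesis RH_radius : cvg_radius (fun k => (c k)%:num) = RH%:E.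
Local Notation H0 := (gen_fun (fun k => (c k)%:num) (expR theta0)).
Local Notation L theta := (fine (laplace c theta)).

Section fixed_sample.
Context (m : nat) (m_gt0 : (0 < m)%N) (theta : 'rV[R]_m).
Context d (T : measurableType d) (P : probability T R) (z : 'I_m -> {RV P >-> nat}).
Hypothesis sample : nef_sample c z theta.

Lemma coord_le_norm i : `|theta ord0 i| <= `|theta|.
Proof.
rewrite [leRHS]/Num.norm/= mx_normrE.
exact: (@le_bigmax _ _ _ _ (fun ij => `|theta ij.1 ij.2|) (ord0, i)).
Qed.

Lemma phi_L_le i : phi_L c theta <= L (theta ord0 i) * expR (theta ord0 i) `^ (4^-1).
Proof.
apply: ge_inf; last by exists i.
exists 0 => _ [j _ <-]; rewrite mulr_ge0 ?powR_ge0//.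
by apply: fine_ge0; apply: integral_ge0 => x _; rewrite lee_fin expR_ge0.
Qed.

(** A bound that depends on theta only through its norm: it makes the variance
    bound uniform over the parameter vectors of norm at most rho. *)
Lemma phi_L_ge (rho : R) : `|theta| <= rho ->
  (c 0%N)%:num * expR (- rho) `^ (4^-1) <= phi_L c theta.
Proof.
have [dom _ _] := sample => thrho; apply: lb_le_inf.
  by eexists; exists (Ordinal m_gt0).
move=> _ [i _ <-]; apply: ler_pM; rewrite ?powR_ge0 ?fine_laplace_ge//.
rewrite ge0_ler_powR ?nnegrE ?expR_ge0 ?invr_ge0// ler_expR lerNl.
rewrite (le_trans _ thrho)// (le_trans _ (coord_le_norm i))//.
by rewrite -normrN ler_norm.
Qed.

Lemma phi_L_gt0 : 0 < phi_L c theta.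
Proof.
by apply: lt_le_trans (phi_L_ge (lexx _)); rewrite mulr_gt0// powR_gt0// expR_gt0.
Qed.

Lemma nef_sampleE i (f : nat -> \bar R) :
  (\int[distribution P (z i)]_x f x = \int[nef c (theta ord0 i)]_x f x)%E.
Proof.
have [_ _ dz] := sample.
by apply: eq_measure_integral => A mA _; exact: dz.
Qed.

Variable t : R.
Hypothesis t_gt0 : 0 < t.
Local Notation K := (Kfun c omega theta0 t).
Let K_bounded k : `|K k| <= H0 * C0 * expR `|t|.
Proof. exact: normr_Kfun_le_cst. Qed.

Let K_Lfun2 i : K \o z i \in Lfun P 2%:E.
Proof.
apply: (@Lfun2_bounded _ _ _ P _ (H0 * C0 * expR `|t|)); first exact: measurableT_comp.
by move=> w; exact: K_bounded.
Qed.

Let K_int i : P.-integrable setT (EFin \o (K \o z i)).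
Proof.
by apply/Lfun1_integrable; rewrite Lfun_subset12 ?fin_num_measure.
Qed.

Lemma expectation_Kfun i : ('E_P[K \o z i] = (psi c omega theta0 t (theta ord0 i))%:E)%E.
Proof.
have [dom _ _] := sample.
rewrite unlock -[LHS](@integral_distribution _ _ _ _ _ P (z i) (EFin \o K))//; last exact: K_int.
rewrite nef_sampleE (integral_Kfun_nef c_gt0 theta0_dom c_inv_le omega_adm)//.
by rewrite (psiE c_gt0 theta0_dom c_inv_le omega_adm).
Qed.

Lemma variance_Kfun_le i : ('V_P[K \o z i] <=
  (H0 ^+ 2 * C0 * (expR (2 * t * RH `^ (2^-1)) / (Num.sqrt t * phi_L c theta)))%:E)%E.
Proof.
have [dom _ _] := sample.
have C00 : 0 <= C0 by apply: le_trans (c_inv_le 0).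
have s0 : 0 < Num.sqrt t by rewrite sqrtr_gt0.
have p0 := phi_L_gt0.
rewrite varianceE//.
apply: (@le_trans _ _ 'E_P[(K \o z i) ^+ 2])%E.
  rewrite expectation_Kfun -EFin_expe leeBlDr// leeDl// lee_fin sqr_ge0//.
rewrite unlock.
have -> : (\int[P]_w (((K \o z i) ^+ 2) w)%:E = \int[nef c (theta ord0 i)]_x (K x ^+ 2)%:E)%E.
  rewrite -nef_sampleE (@ge0_integral_distribution _ _ _ _ _ P (z i) (fun x => (K x ^+ 2)%:E))//.
  by move=> y; rewrite lee_fin sqr_ge0.
apply: le_trans (integral_sqr_Kfun_radius_le c_gt0 theta0_dom c_inv_le omega_adm
  RH_radius t_gt0 (dom i)) _.
rewrite lee_fin; apply: ler_wpM2l; first by rewrite mulr_ge0// sqr_ge0.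
apply: ler_wpM2l; first exact: expR_ge0.
by rewrite lef_pV2 ?posrE ?mulr_gt0 ?powR_gt0 ?expR_gt0 ?fine_laplace_gt0// ler_pM2l// phi_L_le.
Qed.

Let phi_hatE : (fun w => phi_hat c omega theta0 t (fun i => z i w) - phi c omega theta0 t theta) =
  (cst (1 - phi c omega theta0 t theta) \- (m%:R^-1 \o* (fun w => \sum_(i < m) K (z i w))))%R.
Proof.
apply/funext => w; rewrite /phi_hat /= sumrB sumr_const card_ord.
by rewrite mulrBr mulVf ?pnatr_eq0 -?lt0n//; ring.
Qed.

Let sum_Lfun2 : (fun w => \sum_(i < m) K (z i w)) \in Lfun P 2%:E.
Proof.
apply: (@Lfun2_bounded _ _ _ P _ (\sum_(i < m) H0 * C0 * expR `|t|)).
  by apply: measurable_sum => i; exact: measurableT_comp.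
by move=> w; apply: le_trans (ler_norm_sum _ _ _) _; apply: ler_sum.
Qed.

Lemma variance_phi_hat_le :
  ('V_P[(fun w => phi_hat c omega theta0 t (fun i => z i w) - phi c omega theta0 t theta)%R] <=
   (H0 ^+ 2 * C0 / m%:R * (expR (2 * t * RH `^ (2^-1)) / (Num.sqrt t * phi_L c theta)))%:E)%E.
Proof.
have [dom iz _] := sample.
have m0 : m%:R != 0 :> R by rewrite pnatr_eq0 -lt0n.
rewrite phi_hatE varianceB_cst_l; last by rewrite Lfun_scale// ler1n.
rewrite varianceZ// (variance_sum_independent iz K_bounded).
set B := expR _ / _.
apply: (@le_trans _ _ ((m%:R^-1 ^+ 2)%:E * \sum_(i < m) (H0 ^+ 2 * C0 * B)%:E)%E).
  apply: lee_wpmul2l; first by rewrite lee_fin sqr_ge0.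
  by apply: lee_sum => i _; exact: variance_Kfun_le.
rewrite sumEFin sumr_const card_ord -EFinM lee_fin -mulr_natr.
by rewrite le_eqVlt; apply/orP; left; apply/eqP; field.
Qed.

Lemma expectation_phi_hat :
  ('E_P[(fun w => phi_hat c omega theta0 t (fun i => z i w) - phi c omega theta0 t theta)%R] = 0)%E.
Proof.
have m0 : m%:R != 0 :> R by rewrite pnatr_eq0 -lt0n.
have Pfin : P setT \is a fin_num := fin_num_measure P _ measurableT.
rewrite phi_hatE expectationB; last 2 first.
- by rewrite Lfun_cst.
- by rewrite Lfun_subset12// Lfun_scale// ler1n.
rewrite expectation_cst expectationZl; last by rewrite Lfun_subset12.
rewrite (expectation_sum_comp z K_bounded).
under eq_bigr do rewrite expectation_Kfun.
rewrite sumEFin -EFinM -EFinB; congr EFin.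
rewrite /phi sumrB sumr_const card_ord mulrBr mulVf//; ring.
Qed.

Lemma phi_hat_deviation_le (a : R) : 0 < a ->
  (P [set w | (a <= `|phi_hat c omega theta0 t (fun i => z i w) - phi c omega theta0 t theta|)%R] <=
   (a ^- 2 * (H0 ^+ 2 * C0 / m%:R *
     (expR (2 * t * RH `^ (2^-1)) / (Num.sqrt t * phi_L c theta))))%:E)%E.
Proof.
move=> a0; set X := (fun w => phi_hat c omega theta0 t (fun i => z i w) -
  phi c omega theta0 t theta).
have mX : measurable_fun setT X.
  rewrite /X phi_hatE; apply: measurable_funB => //.
  by apply: measurable_funM => //; apply: measurable_sum => i; exact: measurableT_comp.
pose X' : {RV P >-> R} := mfun_Sub (mem_set mX).
have := chebyshev X' a0.
have -> : ('E_P[X'] = 0)%E by exact: expectation_phi_hat.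
under eq_set do rewrite subr0.
move=> /le_trans; apply.
rewrite EFinM; apply: lee_wpmul2l; first by rewrite lee_fin invr_ge0 exprn_ge0// ltW.
exact: variance_phi_hat_le.
Qed.

End fixed_sample.
End estimator_moments.

(** * The uniform consistency class *)

Section consistency_class.
Context {R : realType} (c : nat -> {nonneg R}) (omega : R -> R) (theta0 C0 RH : R).
Hypothesis c_gt0 : forall k, 0 < (c k)%:num.
Hypothesis theta0_dom : nef_domain c theta0.
Hypothesis c_inv_le : forall k, (c k)%:num^-1 <= C0.
Hypothesis omega_adm : admissible omega.
Hypothesis RH_radius : cvg_radius (fun k => (c k)%:num) = RH%:E.
Local Notation H0 := (gen_fun (fun k => (c k)%:num) (expR theta0)).
Local Notation L theta := (fine (laplace c theta)).

(** Since L(theta) >= c_0, the factor H(eta0) / L(theta) of [psiE] is bounded,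
    and the Riemann-Lebesgue lemma gives one threshold for all theta. *)
Lemma psi_vanishing (e : R) : 0 < e -> exists Lam : R,
  forall t theta, nef_domain c theta -> Lam <= `|t * (expR theta - expR theta0)| ->
  `|psi c omega theta0 t theta| <= e.
Proof.
move=> e0; have h0 := gen_fun_gt0 c_gt0 theta0_dom; have c0 := c_gt0 0.
have e1 : 0 < e * (c 0%N)%:num / H0 by rewrite divr_gt0// mulr_gt0.
have [Lam HLam] := riemann_lebesgue (admissible_bounded_measurable omega_adm) e1.
exists Lam => t theta dth /HLam Hx.
have L0 := fine_laplace_gt0 c_gt0 dth; have Lc := fine_laplace_ge c_gt0 dth.
rewrite (psiE c_gt0 theta0_dom c_inv_le omega_adm)// normrM gtr0_norm ?divr_gt0//.
apply: (@le_trans _ _ (H0 / L theta * (e * (c 0%N)%:num / H0))).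
  by apply: ler_wpM2l; [rewrite ltW// divr_gt0|exact: ltW].
rewrite [X in X <= _](_ : _ = e * ((c 0%N)%:num / L theta)); last first.
  by field; rewrite !gt_eqF.
rewrite -[leRHS]mulr1; apply: ler_wpM2l; first exact: ltW.
by rewrite ler_pdivrMr// mul1r.
Qed.

(** A null coordinate contributes 1 - psi = 0 to phi.  Hence the difference is
    minus the sum of psi over the other coordinates, divided by m. *)
Lemma phi_bias_le (m : nat) (theta : 'rV[R]_m) (t e : R) :
  (forall i, i \in nonnull theta0 theta -> `|psi c omega theta0 t (theta ord0 i)| <= e) ->
  `|phi c omega theta0 t theta - nonnull_proportion theta0 theta| <=
  e * nonnull_proportion theta0 theta.
Proof.
move=> He.
have -> : phi c omega theta0 t theta - nonnull_proportion theta0 theta =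
    - (m%:R^-1 * \sum_(i in nonnull theta0 theta) psi c omega theta0 t (theta ord0 i)).
  rewrite /phi (bigID (mem (nonnull theta0 theta)))/= [X in _ * (_ + X)]big1 ?addr0; last first.
    move=> i; rewrite inE negbK => /eqP ->.
    by rewrite (psi_null c_gt0 theta0_dom c_inv_le omega_adm) subrr.
  by rewrite sumrB sumr_const /nonnull_proportion; ring.
rewrite normrN normrM ger0_norm ?invr_ge0// /nonnull_proportion mulrA mulrC.
apply: ler_wpM2r; first by rewrite invr_ge0.
apply: le_trans (ler_norm_sum _ _ _) _; apply: le_trans (ler_sum _ He) _.
by rewrite sumr_const mulr_natr.
Qed.

Lemma measurable_phi_hat (m : nat) d (T : measurableType d) (P : probability T R)
    (z : 'I_m -> {RV P >-> nat}) (t : R) :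
  measurable_fun setT (fun w => phi_hat c omega theta0 t (fun i => z i w)).
Proof.
apply: measurable_funM => //; apply: measurable_sum => i.
by apply: measurable_funB => //; exact: measurableT_comp.
Qed.

Lemma near_infty_ln_ge (A : R) : \forall m \near \oo, A <= ln (m%:R : R).
Proof.
near=> m; have Am : expR A < m%:R by near: m; exact: nbhs_infty_gtr.
by rewrite -[A]expRK ler_ln ?posrE ?expR_gt0 ?(lt_trans (expR_gt0 A))// ltW.
Unshelve. all: by end_near. Qed.

(** With l = ln m and t = tau l, the separation condition gives
    t |eta_i - eta0| >= tau l ln l / sqrt (2 l) >= (tau / 2) sqrt (2 l), which
    makes the bias small.  The Chebyshev bound contains the quotient of
    m^gamma / m by pi_{1,m}^2, which is at most one on the class.  Both errors
    are kept below eps / 2, relatively to pi_{1,m}. *)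
Lemma consistency_class_Q_II1 (rho gamma : R) : 0 < gamma <= 1 ->
  uniform_consistency_class c omega theta0 (Q_II1 theta0 RH rho gamma).
Proof.
move=> /andP[g0 g1] eps delta eps0 delta0.
have h0 := gen_fun_gt0 c_gt0 theta0_dom; have c0 := c_gt0 0.
have C00 : 0 < C0 by apply: lt_le_trans (c_inv_le 0); rewrite invr_gt0.
have RH0 : 0 < RH := lt_le_trans (expR_gt0 _) (expR_le_cvg_radius RH_radius theta0_dom).
have eps2 : 0 < eps / 2 by rewrite divr_gt0.
have [Lam HLam] := psi_vanishing eps2.
pose tau := 2^-1 * RH `^ (- 2^-1) * gamma.
have tau0 : 0 < tau by rewrite !mulr_gt0// ?powR_gt0// invr_gt0.
pose C := H0 ^+ 2 * C0; have CC0 : 0 < C by rewrite mulr_gt0// exprn_gt0.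
pose ph0 := (c 0%N)%:num * expR (- rho) `^ (4^-1).
have ph00 : 0 < ph0 by rewrite mulr_gt0// powR_gt0// expR_gt0.
(* As soon as W <= sqrt t, the Chebyshev bound is at most delta. *)
pose W := C / (eps / 2) ^+ 2 / (ph0 * delta).
have W0 : 0 < W.
  by apply: divr_gt0; [apply: divr_gt0 => //; exact: exprn_gt0|exact: mulr_gt0].
near=> m => theta [t [/= thrho tE pim sep]] d T P z sample.
have := sample => -[dom _ _].
(* The bounds l1 and l2 serve the bias (l1 gives ln l >= 1), l3 the deviation. *)
have l1 : expR 1 <= ln (m%:R : R) by near: m; exact: near_infty_ln_ge.
have l2 : (2 * Lam / tau) ^+ 2 / 2 <= ln (m%:R : R) by near: m; exact: near_infty_ln_ge.
have l3 : W ^+ 2 / tau <= ln (m%:R : R) by near: m; exact: near_infty_ln_ge.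
set l := ln (m%:R : R) in l1 l2 l3 tE sep *.
have l0 : 0 < l by apply: lt_le_trans l1; exact: expR_gt0.
have m0 : (0 < m)%N.
  by rewrite lt0n; apply/eqP => mE; move: l0; rewrite /l mE ln0// ltxx.
have m0R : 0 < m%:R :> R by rewrite ltr0n.
have mE : m%:R = expR l by rewrite lnK// posrE.
rewrite -/tau in tE.
have t0 : 0 < t by rewrite tE mulr_gt0.
set pi1 := nonnull_proportion theta0 theta in pim *.
have pi0 : 0 < pi1 by apply: lt_le_trans pim; rewrite powR_gt0.
have bias : `|phi c omega theta0 t theta - pi1| <= eps / 2 * pi1.
  apply: phi_bias_le => i inn; apply: HLam => //.
  have s0 : 0 < Num.sqrt (2 * l) by rewrite sqrtr_gt0 mulr_gt0.
  have sE : Num.sqrt (2 * l) ^+ 2 = 2 * l by rewrite sqr_sqrtr// ltW// mulr_gt0.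
  have Ls : 2 * Lam / tau <= Num.sqrt (2 * l).
    apply: le_trans (ler_norm _) _; rewrite -sqrtr_sqr ler_sqrt; last by rewrite mulr_ge0// ltW.
    by rewrite -ler_pdivrMl// mulrC.
  have lnl : 1 <= ln l by rewrite -[1]expRK ler_ln// posrE// expR_gt0.
  rewrite normrM (gtr0_norm t0) tE distrC.
  apply: (@le_trans _ _ (tau * l * (1 / Num.sqrt (2 * l)))); last first.
    apply: ler_wpM2l; first by rewrite mulr_ge0// ltW.
    apply: le_trans (sep i inn); apply: ler_wpM2r => //; exact: lnl.
  rewrite [leRHS](_ : _ = tau / 2 * Num.sqrt (2 * l)); last first.
    have lE : l = Num.sqrt (2 * l) ^+ 2 / 2 by rewrite sE; field.
    by rewrite [X in tau * X]lE; field; rewrite gt_eqF.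
  rewrite [leLHS](_ : _ = tau / 2 * (2 * Lam / tau)); last by field; rewrite gt_eqF.
  by rewrite ler_pM2l// divr_gt0.
have a0 : 0 < eps / 2 * pi1 by rewrite mulr_gt0.
have dev := phi_hat_deviation_le c_gt0 theta0_dom c_inv_le omega_adm RH_radius m0 sample t0 a0.
set X := phi_hat c omega theta0 t in dev.
have Wt : W <= Num.sqrt t.
  rewrite -(ger0_norm (ltW W0)) -sqrtr_sqr ler_sqrt ?(ltW t0)//.
  by rewrite tE mulrC -ler_pdivrMr.
have ph1 : ph0 <= phi_L c theta by exact: phi_L_ge sample _ _.
have small : (eps / 2 * pi1) ^- 2 * (C / m%:R *
    (expR (2 * t * RH `^ (2^-1)) / (Num.sqrt t * phi_L c theta))) <= delta.
  have -> : 2 * t * RH `^ (2^-1) = gamma * l.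
    rewrite tE /tau powRN; field.
    by rewrite gt_eqF// powR_gt0.
  have pi2 : expR (gamma * l) / m%:R <= pi1 ^+ 2.
    apply: (@le_trans _ _ ((m%:R `^ ((gamma - 1) / 2)) ^+ 2)); last first.
      by rewrite lerXn2r// ?nnegrE ?powR_ge0// ltW.
    rewrite -powR_mulrn ?powR_ge0// -powRrM divfK// mE -expRB /powR gt_eqF ?expR_gt0//.
    by rewrite expRK ler_expR mulrBl mul1r.
  rewrite [leLHS](_ : _ = C / (eps / 2) ^+ 2 * ((expR (gamma * l) / m%:R) / pi1 ^+ 2) /
      (Num.sqrt t * phi_L c theta)); last first.
    field; rewrite !gt_eqF// ?sqrtr_gt0// (lt_le_trans ph00 ph1)//.
  apply: (@le_trans _ _ (C / (eps / 2) ^+ 2 * 1 / (W * ph0))).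
    apply: ler_pM.
    - by rewrite !mulr_ge0// ?invr_ge0 ?exprn_ge0 ?expR_ge0 ?(ltW CC0) ?(ltW pi0)// ltW.
    - by rewrite invr_ge0 mulr_ge0 ?sqrtr_ge0// (le_trans (ltW ph00)).
    - apply: ler_wpM2l; first by rewrite divr_ge0 ?exprn_ge0 ?ltW.
      by rewrite ler_pdivrMr ?mul1r// exprn_gt0.
    - have ph2 := lt_le_trans ph00 ph1.
      have Wp : 0 < W * ph0 by exact: mulr_gt0.
      have tp : 0 < Num.sqrt t * phi_L c theta by rewrite mulr_gt0// sqrtr_gt0.
      rewrite lef_pV2//.
      by apply: ler_pM => //; exact: ltW.
  rewrite mulr1 /W le_eqVlt; apply/orP; left; apply/eqP; field.
  by rewrite !gt_eqF.
have mX : measurable_fun setT (fun w => X (fun i => z i w)) by exact: measurable_phi_hat.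
pose B := [set w | eps / 2 * pi1 <= `|X (fun i => z i w) - phi c omega theta0 t theta|].
have mB : measurable B.
  have mh : measurable_fun setT (fun w => `|X (fun i => z i w) - phi c omega theta0 t theta|).
    by apply: measurableT_comp => //; exact: measurable_funB.
  have mI : measurable (`[eps / 2 * pi1, +oo[%classic : set R) by exact: measurable_itv.
  have := mh measurableT _ mI.
  congr measurable; rewrite setTI.
  by apply/seteqP; split => w; rewrite /B/preimage/= in_itv/= andbT.
have PB : (P B <= delta%:E)%E.
  by apply: le_trans dev _; rewrite lee_fin.
(* In the class t is determined by m: the supremum is over a single point. *)
have tS : [set t' | Q_II1 theta0 RH rho gamma (theta, t')] = [set t].
  apply/seteqP; split => t' /=.
    by move=> [_ /= -> _ _]; rewrite tE.
  by move=> ->; split => //=; rewrite tE.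
rewrite tS; under eq_set do rewrite image_set1 ereal_sup1.
set S := (X in P X).
have mS : measurable S.
  have mh : measurable_fun setT (fun w => `|pi1^-1 * X (fun i => z i w) - 1|).
    by apply: measurableT_comp => //; apply: measurable_funB => //; exact: measurable_funM.
  have mI : measurable (`]-oo, eps]%classic : set R) by exact: measurable_itv.
  have := mh measurableT _ mI.
  congr measurable; rewrite setTI.
  by apply/seteqP; split => w; rewrite /S/preimage/= in_itv/= lee_fin.
apply: (@le_trans _ _ (P (~` B))).
  by rewrite probability_setC// EFinB leeB.
apply: le_measure; rewrite ?inE//; first exact: measurableC.
move=> w /negP; rewrite -ltNge => Bw.
rewrite /S/= lee_fin.
have pi1E x : pi1^-1 * x - 1 = pi1^-1 * (x - pi1) by rewrite mulrBr mulVf// gt_eqF.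
rewrite pi1E.
rewrite normrM gtr0_norm ?invr_gt0// mulrC ler_pdivrMr//.
have := ler_normD (X (fun i => z i w) - phi c omega theta0 t theta)
  (phi c omega theta0 t theta - pi1).
rewrite addrA subrK => /le_trans; apply.
by rewrite [eps]splitr mulrDl lerD// ltW.
Unshelve. all: by end_near. Qed.

End consistency_class.

(** The threshold 1 for t suffices, the second moment bound holding for all
    t > 0. *)
Theorem corollary5 (R : realType) (c : nat -> {nonneg R})
    (c_gt0 : forall k, 0 < (c k)%:num)
    (theta0 : R) (theta0_dom : nef_domain c theta0)
    (omega : R -> R) (omega_adm : admissible omega)
    (rho : R) (rho_gt0 : 0 < rho)
    (C0 : R) (C0_gt0 : 0 < C0)
    (c_bound : forall k, ((c k)%:num * k`!%:R)^-1 <= C0 / k`!%:R)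
    (RH : R) (RH_radius : cvg_radius (fun k => (c k)%:num) = RH%:E) :
  (exists C t0 : R, [/\ 0 < C, 0 < t0 &
     forall (m : nat), (0 < m)%N ->
     forall (theta : 'rV[R]_m) (d : measure_display) (T : measurableType d) (P : probability T R)
            (z : 'I_m -> {RV P >-> nat}), nef_sample c z theta ->
     forall t : R, t0 <= t ->
     ('V_P[(fun w => phi_hat c omega theta0 t (fun i => z i w)
                     - phi c omega theta0 t theta)%R]
      <= (C / m%:R * (expR (2 * t * RH `^ (2^-1))
                      / (Num.sqrt t * phi_L c theta)))%R%:E)%E])
  /\
  (forall gamma : R, 0 < gamma <= 1 ->
     uniform_consistency_class c omega theta0 (Q_II1 theta0 RH rho gamma)).
Proof.
have c_inv_le k : (c k)%:num^-1 <= C0.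
  have kf : 0 < (k`!%:R)^-1 :> R by rewrite invr_gt0 ltr0n fact_gt0.
  by have := c_bound k; rewrite invfM ler_pM2r.
have h0 := gen_fun_gt0 c_gt0 theta0_dom.
split; last by move=> gamma; exact: consistency_class_Q_II1.
exists (gen_fun (fun k => (c k)%:num) (expR theta0) ^+ 2 * C0), 1.
split => //; first by rewrite mulr_gt0// exprn_gt0.
move=> m m0 theta d T P z sample t t1.
apply: variance_phi_hat_le => //; exact: lt_le_trans t1.
Qed.
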